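(* The normal form of a routing net $\mathcal S$ is a routing area $\mathbf R=(I,O,R)$ for some finite sets $I,O$ and multirelation $R$ between them.
   Context: A multirelation between finite sets $A$ and $B$ is a map $A\times B\to\mathbb N$. A routing net is a net correct for the Ehrhard–Regnier correctness criterion for differential proof nets, composed only of weakenings (0-ary $?$), coweakenings (0-ary $!$), contractions (binary $?$), cocontractions (binary $!$) and possibly floating wires, all wires labelled by the same formula $!A$. Nets are considered modulo associativity/commutativity of contraction and of cocontraction and neutrality of weakening (resp. coweakening) for contraction (resp. cocontraction). Reduction rules: (ba) contraction facing cocontraction (principal ports connected) replaced by two contractions and two cocontractions connected crosswise; (s1) coweakening facing contraction becomes two coweakenings; (s2) cocontraction facing weakening becomes two weakenings; ($\epsilon$) coweakening facing weakening is erased. Routing area $(I,O,R)$: the net with free wires labelled by $I$ (inputs) and $O$ (outputs), each input connected to the principal port of a contraction tree, each output to the principal port of a cocontraction tree, the tree of input $i$ connected to the tree of output $o$ by exactly $R(i,o)$ wires (a tree with 0 leaves is a (co)weakening, with 1 leaf a plain wire). *)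

(* Defs.v *)
From HB Require Import structures.
From mathcomp Require Import all_boot.
From Stdlib Require Export Relation_Operators.

Set Implicit Arguments.
Unset Strict Implicit.
Unset Printing Implicit Defensive.

Definition multirelation (A B : finType) : Type := A * B -> nat.

(* All wires carry the same formula !A, so each wire is oriented along !A: it
   starts at a free input or at a port emitting !A, and ends at a free output
   or at a port receiving !A.  Wires are named by natural numbers; names are
   bound (see [alpha] below). *)
Definition wire := nat.

(* Contr a b c   : principal port on a (received), auxiliary ports b, c.
   Cocontr a b c : auxiliary ports a, b (received), principal port c.    *)
Inductive cell : Type :=
| Weak of wire
| Coweak of wire
| Contr of wire & wire & wire
| Cocontr of wire & wire & wire.

Definition cell_code (c : cell) : nat * (wire * wire * wire) :=
  match c with
  | Weak a => (0, (a, 0, 0))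
  | Coweak a => (1, (a, 0, 0))
  | Contr a b c => (2, (a, b, c))
  | Cocontr a b c => (3, (a, b, c))
  end.

Definition cell_decode (x : nat * (wire * wire * wire)) : cell :=
  let: (k, (a, b, c)) := x in
  match k with
  | 0 => Weak a
  | 1 => Coweak a
  | 2 => Contr a b c
  | _ => Cocontr a b c
  end.

Lemma cell_codeK : cancel cell_code cell_decode.
Proof. by case. Qed.

HB.instance Definition _ := Equality.copy cell (can_type cell_codeK).

Definition received (c : cell) : seq wire :=
  match c with
  | Weak a => [:: a]
  | Coweak _ => [::]
  | Contr a _ _ => [:: a]
  | Cocontr a b _ => [:: a; b]
  end.

Definition emitted (c : cell) : seq wire :=
  match c with
  | Weak _ => [::]
  | Coweak a => [:: a]
  | Contr _ b c => [:: b; c]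
  | Cocontr _ _ c => [:: c]
  end.

Definition rename (f : wire -> wire) (c : cell) : cell :=
  match c with
  | Weak a => Weak (f a)
  | Coweak a => Coweak (f a)
  | Contr a b c => Contr (f a) (f b) (f c)
  | Cocontr a b c => Cocontr (f a) (f b) (f c)
  end.

(* Nets whose free input (output) wires are labelled by I (by O).
   [wires_linear]: every wire has exactly one start and exactly one end.  In
   particular the entries of [cells] are pairwise distinct.  A floating wire
   is an input and an output with the same name.  Wires closing up on
   themselves without any port, which no correct net has, are left out. *)
Record net (I O : finType) : Type := Net {
  inp : {ffun I -> wire};
  out : {ffun O -> wire};
  cells : seq cell;
  wires_linear :
    let starts := codom inp ++ flatten (map emitted cells) in
    let ends := codom out ++ flatten (map received cells) in
    uniq starts && perm_eq starts ends
}.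

(* Correctness: for every switching, which detaches one auxiliary port of
   each contraction, the resulting undirected multigraph (cells and free ports
   as vertices, wires as edges) is acyclic.  Connectedness is not required. *)
Section Correctness.
Variables (I O : finType).

Inductive vertex : Type :=
| VCell of cell
| VInput of I
| VOutput of O
| VLoose of wire.

(* Only the values of a switching on the contractions matter. *)
Definition switching := cell -> bool.

Definition detached (s : switching) (c : cell) (w : wire) : bool :=
  if c is Contr _ b d then w == (if s c then d else b) else false.

Variables (s : switching) (N : net I O).

Inductive wire_start : wire -> vertex -> Prop :=
| StartInput (i : I) : wire_start (inp N i) (VInput i)
| StartCell (c : cell) (w : wire) :
    c \in cells N -> w \in emitted c ->
    wire_start w (if detached s c w then VLoose w else VCell c).

Inductive wire_end : wire -> vertex -> Prop :=
| EndOutput (o : O) : wire_end (out N o) (VOutput o)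
| EndCell (c : cell) (w : wire) :
    c \in cells N -> w \in received c -> wire_end w (VCell c).

Definition joins (w : wire) (u v : vertex) : Prop :=
  wire_start w u /\ wire_end w v.

Inductive walk : vertex -> seq wire -> vertex -> Prop :=
| WalkNil (v : vertex) : walk v [::] v
| WalkCons (u v v' : vertex) (w : wire) (p : seq wire) :
    joins w u v \/ joins w v u -> walk v p v' -> walk u (w :: p) v'.

Definition acyclic : Prop :=
  forall (v : vertex) (p : seq wire), uniq p -> walk v p v -> p = [::].

End Correctness.

Definition routing_net (I O : finType) (N : net I O) : Prop :=
  forall s : switching, acyclic s N.

(* Replacement, inside a net, of the cells [lhs] by the cells [rhs].  Linearity
   of N' forces the internal wires of [rhs] to be fresh. *)
Definition rewrites (rule : seq cell -> seq cell -> Prop)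
    (I O : finType) (N N' : net I O) : Prop :=
  exists lhs rhs rest : seq cell,
    rule lhs rhs /\
    [/\ inp N' = inp N, out N' = out N,
        perm_eq (cells N) (lhs ++ rest) & perm_eq (cells N') (rhs ++ rest)].

Inductive reduction_rule : seq cell -> seq cell -> Prop :=
| rule_ba (a b c d e w x y z : wire) :
    reduction_rule [:: Cocontr a b c; Contr c d e]
                   [:: Contr a w x; Contr b y z; Cocontr w y d; Cocontr x z e]
| rule_s1 (c d e : wire) :
    reduction_rule [:: Coweak c; Contr c d e] [:: Coweak d; Coweak e]
| rule_s2 (a b c : wire) :
    reduction_rule [:: Cocontr a b c; Weak c] [:: Weak a; Weak b]
| rule_eps (c : wire) :
    reduction_rule [:: Coweak c; Weak c] [::].

Definition step (I O : finType) : net I O -> net I O -> Prop :=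
  @rewrites reduction_rule I O.

Inductive ac_rule : seq cell -> seq cell -> Prop :=
| contr_assoc (a b c d x y : wire) :
    ac_rule [:: Contr a b x; Contr x c d] [:: Contr a y d; Contr y b c]
| contr_comm (a b c : wire) :
    ac_rule [:: Contr a b c] [:: Contr a c b]
| cocontr_assoc (a b c d x y : wire) :
    ac_rule [:: Cocontr b c x; Cocontr a x d] [:: Cocontr a b y; Cocontr y c d]
| cocontr_comm (a b c : wire) :
    ac_rule [:: Cocontr a b c] [:: Cocontr b a c].

(* [neutral_rule lhs a b]: the cells [lhs] amount to plugging the end of the
   wire a into the start of the wire b. *)
Inductive neutral_rule : seq cell -> wire -> wire -> Prop :=
| contr_neutral (a b c : wire) :
    neutral_rule [:: Contr a b c; Weak c] a b
| cocontr_neutral (a b c : wire) :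
    neutral_rule [:: Cocontr a c b; Coweak c] a b.

Definition fuse (a b : wire) : wire -> wire :=
  fun w => if w == b then a else w.

(* a != b: otherwise erasing [lhs] would leave a closed wire. *)
Definition neutrality (I O : finType) (N N' : net I O) : Prop :=
  exists (lhs rest : seq cell) (a b : wire),
    [/\ neutral_rule lhs a b, a != b & perm_eq (cells N) (lhs ++ rest)] /\
    [/\ inp N' = inp N, out N' = [ffun o => fuse a b (out N o)] &
        perm_eq (cells N') (map (rename (fuse a b)) rest)].

(* Irrelevance of the names of wires and of the enumeration of cells. *)
Definition alpha (I O : finType) (N N' : net I O) : Prop :=
  exists f : wire -> wire,
    injective f /\
    [/\ inp N' = [ffun i => f (inp N i)], out N' = [ffun o => f (out N o)] &
        perm_eq (cells N') (map (rename f) (cells N))].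

Definition net_equiv (I O : finType) : net I O -> net I O -> Prop :=
  clos_refl_sym_trans (net I O)
    (fun N N' => [\/ alpha N N', rewrites ac_rule N N' | neutrality N N']).

Definition reduces (I O : finType) : net I O -> net I O -> Prop :=
  clos_refl_trans (net I O) (fun N N' => net_equiv N N' \/ step N N').

(* Normality bears on a representative: read backwards, neutrality creates a
   redex on any wire, so that no nonempty equivalence class has all its
   representatives redex-free. *)
Definition normal (I O : finType) (N : net I O) : Prop :=
  forall N' : net I O, ~ step N N'.

Definition normal_form (I O : finType) (N N' : net I O) : Prop :=
  reduces N N' /\ normal N'.

(* [.. root leaves cs]: the cells cs form a tree with the given root and
   leaves, where the tree with one leaf is a plain wire. *)
Inductive contr_branch : wire -> seq wire -> seq cell -> Prop :=
| contr_leaf (a : wire) : contr_branch a [:: a] [::]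
| contr_node (a b c : wire) (l l' : seq wire) (t t' : seq cell) :
    contr_branch b l t -> contr_branch c l' t' ->
    contr_branch a (l ++ l') (Contr a b c :: t ++ t').

Inductive contr_tree : wire -> seq wire -> seq cell -> Prop :=
| contr_tree0 (a : wire) : contr_tree a [::] [:: Weak a]
| contr_treeS (a : wire) (l : seq wire) (t : seq cell) :
    contr_branch a l t -> contr_tree a l t.

Inductive cocontr_branch : wire -> seq wire -> seq cell -> Prop :=
| cocontr_leaf (a : wire) : cocontr_branch a [:: a] [::]
| cocontr_node (a b c : wire) (l l' : seq wire) (t t' : seq cell) :
    cocontr_branch a l t -> cocontr_branch b l' t' ->
    cocontr_branch c (l ++ l') (Cocontr a b c :: t ++ t').

Inductive cocontr_tree : wire -> seq wire -> seq cell -> Prop :=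
| cocontr_tree0 (a : wire) : cocontr_tree a [::] [:: Coweak a]
| cocontr_treeS (a : wire) (l : seq wire) (t : seq cell) :
    cocontr_branch a l t -> cocontr_tree a l t.

(* N is the routing area (I, O, R); [link (i, o)] lists the R (i, o) wires from
   the tree of i to the tree of o. *)
Definition routing_area (I O : finType) (R : multirelation I O)
    (N : net I O) : Prop :=
  exists (link : I * O -> seq wire) (ti : I -> seq cell) (to : O -> seq cell),
    [/\ forall x : I * O, size (link x) = R x,
        forall i : I,
          contr_tree (inp N i) (flatten [seq link (i, o) | o : O]) (ti i),
        forall o : O,
          cocontr_tree (out N o) (flatten [seq link (i, o) | i : I]) (to o) &
        perm_eq (cells N)
          (flatten [seq ti i | i : I] ++ flatten [seq to o | o : O])].

(* Main.v *)
(* A valuation of the wires that copies along contractions and adds along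
   cocontractions counts directed paths from the inputs.  Correctness rules out
   directed cycles, so such valuations exist, and the matrix R of path counts is
   invariant under equivalence and reduction.  Counting also the paths that start
   at a cell of type ! gives a valuation whose sum over the principal wires of the
   cells of type ? drops by one at each step, whence termination.  In a normal net
   no two cells face each other, so every input is the root of a tree of
   contractions and every output that of a tree of cocontractions; up to
   equivalence such a net is determined by R. *)

Require Import Defs.
From mathcomp Require Import all_boot.
From mathcomp Require Import zify.
From Stdlib Require Import Classical.

Set Implicit Arguments.
Unset Strict Implicit.
Unset Printing Implicit Defensive.

(** Correctness is used on the initial net only, and its preservation by reduction is never proved.
    What travels along reductions is a valuation together with a rank [rho] that increases strictly
    through contractions and cocontractions; this is enough to exclude directed cycles later on. The
    valuation that also counts paths starting at cells of type ! is not stable under neutrality: a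
    coweakening plugged into a cocontraction adds 2 to the value that passes through. Termination is
    therefore shown for plain steps with no equivalence in between, which is enough for existence.
    Uniqueness comes from the invariant matrix alone, without confluence. The trees of a routing
    area are awkward to transform, because a tree with one leaf is a wire, whose name is both root
    and leaf. Hence an identity (a cell of arity two with a weakening or coweakening on an auxiliary
    port) is first inserted at every free port, all other cells are absorbed into the combs so
    started, and the identities are erased only at the very end. *)

Definition cnt (w : wire) (s : seq wire) : nat := count_mem w s.

Arguments cnt : simpl never.

Lemma cnt_cons w a s : cnt w (a :: s) = (a == w) + cnt w s.
Proof. by []. Qed.

Lemma cnt_cat w s t : cnt w (s ++ t) = cnt w s + cnt w t.
Proof. exact: count_cat. Qed.

Lemma uniq_cnt s : (forall w, cnt w s <= 1) -> uniq s.
Proof.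
move=> s1; apply: count_mem_uniq => x; have := s1 x; rewrite /cnt.
by case: (boolP (x \in s)) => [|/count_memPn -> //]; rewrite -has_pred1 has_count; lia.
Qed.

Lemma cnt_uniq w s : uniq s -> cnt w s <= 1.
Proof. by rewrite /cnt => /count_uniq_mem ->; case: (w \in s). Qed.

Lemma cnt_gt0 w s : (0 < cnt w s) = (w \in s).
Proof. by rewrite -has_count has_pred1. Qed.

Lemma cnt_eq0 w s : (cnt w s == 0) = (w \notin s).
Proof. by rewrite -cnt_gt0 lt0n negbK. Qed.

Lemma cnt_perm s t : perm_eq s t -> forall w, cnt w s = cnt w t.
Proof. by move=> /permP st w; apply: st. Qed.

(** Together with [uniq_cnt], this turns the linearity of a net into linear arithmetic on occurrence
    counts, which [lia] settles. *)
Lemma perm_cnt s t : (forall w, cnt w s = cnt w t) -> perm_eq s t.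
Proof. by move=> st; apply/allP => w _; apply/eqP/st. Qed.

(** * Nets seen from either side *)

(* Reversing all wires exchanges inputs with outputs and contractions with
   cocontractions.  A boolean [s] selects the side: [true] for inputs and
   contractions, [false] for outputs and cocontractions. *)
Definition nd (s : bool) (a b c : wire) : cell :=
  if s then Contr a b c else Cocontr b c a.

Definition lf (s : bool) (a : wire) : cell := if s then Weak a else Coweak a.

Definition kind (c : cell) : bool :=
  match c with Weak _ | Contr _ _ _ => true | _ => false end.

Definition principal (c : cell) : wire :=
  match c with
  | Weak a => a
  | Coweak a => a
  | Contr a _ _ => a
  | Cocontr _ _ c => c
  end.

Definition near (s : bool) (c : cell) : seq wire :=
  if s then received c else emitted c.

Definition nears (s : bool) (C : seq cell) : seq wire := flatten (map (near s) C).

Definition rn (f : wire -> wire) : seq cell -> seq cell := map (rename f).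

Variant cell_spec : cell -> Prop :=
| SpecNd s a b c : cell_spec (nd s a b c)
| SpecLf s a : cell_spec (lf s a).

Lemma cellP c : cell_spec c.
Proof.
case: c => [a|a|a b c|a b c].
- exact: (SpecLf true).
- exact: (SpecLf false).
- exact: (SpecNd true).
- exact: (SpecNd false c a b).
Qed.

Lemma near_nd s t a b c : near s (nd t a b c) = if s == t then [:: a] else [:: b; c].
Proof. by case: s; case: t. Qed.

Lemma near_lf s t a : near s (lf t a) = if s == t then [:: a] else [::].
Proof. by case: s; case: t. Qed.

Lemma near_kind c : near (kind c) c = [:: principal c].
Proof. by case: c. Qed.

Lemma principal_nd s a b c : principal (nd s a b c) = a. Proof. by case: s. Qed.
Lemma principal_lf s a : principal (lf s a) = a. Proof. by case: s. Qed.
Lemma kind_nd s a b c : kind (nd s a b c) = s. Proof. by case: s. Qed.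
Lemma kind_lf s a : kind (lf s a) = s. Proof. by case: s. Qed.

Definition cellE := (near_nd, near_lf, principal_nd, principal_lf, kind_nd, kind_lf).

Lemma nears_cons s c C : nears s (c :: C) = near s c ++ nears s C.
Proof. by []. Qed.

Lemma nears_cat s C C' : nears s (C ++ C') = nears s C ++ nears s C'.
Proof. by rewrite /nears map_cat flatten_cat. Qed.

Lemma perm_nears s C C' : perm_eq C C' -> perm_eq (nears s C) (nears s C').
Proof. by move=> CC; apply/perm_flatten/perm_map. Qed.

Lemma count_nears s C C' : perm_eq C C' ->
  forall x, cnt x (nears s C) = cnt x (nears s C').
Proof. by move=> CC; apply: cnt_perm (perm_nears s CC). Qed.

Lemma mem_nears s C c w : c \in C -> w \in near s c -> w \in nears s C.
Proof. by move=> cC wc; apply/flattenP; exists (near s c) => //; apply: map_f. Qed.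

Lemma nearsP s C w : reflect (exists2 c, c \in C & w \in near s c) (w \in nears s C).
Proof. exact: flatten_mapP. Qed.

Lemma rename_nd f s a b c : rename f (nd s a b c) = nd s (f a) (f b) (f c).
Proof. by case: s. Qed.

Lemma rename_lf f s a : rename f (lf s a) = lf s (f a).
Proof. by case: s. Qed.

Lemma near_rename f s c : near s (rename f c) = map f (near s c).
Proof. by case: s; case: c. Qed.

Lemma nears_rn f s C : nears s (rn f C) = map f (nears s C).
Proof. by elim: C => //= c C IH; rewrite !nears_cons near_rename map_cat IH. Qed.

Lemma rename_comp f g c : rename f (rename g c) = rename (f \o g) c.
Proof. by case: c. Qed.

Lemma rn_comp f g C : rn f (rn g C) = rn (f \o g) C.
Proof. by rewrite /rn -map_comp; apply: eq_map => c; apply: rename_comp. Qed.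

Lemma rn_cat f C C' : rn f (C ++ C') = rn f C ++ rn f C'.
Proof. exact: map_cat. Qed.

Lemma rn_eq f g C :
  (forall w s, w \in nears s C -> f w = g w) -> rn f C = rn g C.
Proof.
move=> fg; apply/eq_in_map => c cC.
have fgc w s : w \in near s c -> f w = g w by move=> /(mem_nears cC) /fg.
move: fgc; case: c {cC} => [a|a|a b c|a b c] fgc /=; f_equal;
  by [apply: (fgc _ true); rewrite !inE eqxx ?orbT
     |apply: (fgc _ false); rewrite !inE eqxx ?orbT].
Qed.

Lemma rn_id C : rn id C = C.
Proof. by elim: C => //= c C ->; case: c. Qed.

Lemma kind_rename f c : kind (rename f c) = kind c. Proof. by case: c. Qed.
Lemma principal_rename f c : principal (rename f c) = f (principal c). Proof. by case: c. Qed.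

Definition side (I O : finType) (s : bool) : finType := if s then I else O.

Arguments side : simpl never.

Section Nets.
Variables I O : finType.
Implicit Types (N : net I O) (s : bool) (C : seq cell).

Definition port N s : side I O s -> wire :=
  if s return side I O s -> wire then inp N else out N.

Arguments port : simpl never.

Lemma port_linear s N :
  uniq (codom (port N (s:=s)) ++ nears (~~ s) (cells N)) /\
  perm_eq (codom (port N (s:=s)) ++ nears (~~ s) (cells N))
          (codom (port N (s:=~~ s)) ++ nears s (cells N)).
Proof.
have /andP[uN pN] := wires_linear N.
by case: s; split=> //; [rewrite -(perm_uniq pN)|rewrite perm_sym].
Qed.

Lemma port_count s N w :
  cnt w (codom (port N (s:=s))) + cnt w (nears (~~ s) (cells N)) <= 1 /\
  cnt w (codom (port N (s:=s))) + cnt w (nears (~~ s) (cells N))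
  = cnt w (codom (port N (s:=~~ s))) + cnt w (nears s (cells N)).
Proof.
have [uN pN] := port_linear s N.
by have := @cnt_uniq w _ uN; have := cnt_perm pN w; rewrite !cnt_cat.
Qed.

Definition unused N (w : wire) : Prop :=
  (forall s, w \notin nears s (cells N)) /\ (forall s x, w != port N (s:=s) x).

(** The bound is asked at one extremity of the wires only; the equation carries it over to the
    other, so that one statement serves both sides. *)
Lemma mk_net s (p : side I O s -> wire) (q : side I O (~~ s) -> wire) C :
  (forall w, cnt w (codom p) + cnt w (nears (~~ s) C) <= 1 /\
    cnt w (codom p) + cnt w (nears (~~ s) C)
    = cnt w (codom q) + cnt w (nears s C)) ->
  exists N, [/\ port N (s:=s) =1 p, port N (s:=~~ s) =1 q & cells N = C].
Proof.
move=> lin.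
have u : uniq (codom p ++ nears (~~ s) C).
  by apply: uniq_cnt => w; have [] := lin w; rewrite cnt_cat.
have pe : perm_eq (codom p ++ nears (~~ s) C) (codom q ++ nears s C).
  by apply: perm_cnt => w; have [] := lin w; rewrite !cnt_cat.
have codomE (X : finType) (f : X -> wire) : codom [ffun x => f x] = codom f.
  by apply: eq_codom => x; rewrite ffunE.
case: s p q {lin} u pe => /= p q u pe.
- have lin : uniq (codom [ffun i => p i] ++ flatten (map emitted C)) &&
      perm_eq (codom [ffun i => p i] ++ flatten (map emitted C))
              (codom [ffun o => q o] ++ flatten (map received C)).
    by rewrite !codomE u pe.
  by exists (Net lin); split=> // x; rewrite /port /= ffunE.
- have lin : uniq (codom [ffun i => q i] ++ flatten (map emitted C)) &&
      perm_eq (codom [ffun i => q i] ++ flatten (map emitted C))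
              (codom [ffun o => p o] ++ flatten (map received C)).
    by rewrite !codomE -(perm_uniq pe) u perm_sym pe.
  by exists (Net lin); split=> // x; rewrite /port /= ffunE.
Qed.

Lemma replace_cells N lhs rhs rest (K K' D A : seq wire) :
  perm_eq (cells N) (lhs ++ rest) ->
  perm_eq (nears false lhs) (K ++ D) -> perm_eq (nears true lhs) (K ++ A) ->
  perm_eq (nears false rhs) (K' ++ D) -> perm_eq (nears true rhs) (K' ++ A) ->
  uniq K' -> {in K', forall w, unused N w} ->
  exists N', [/\ inp N' = inp N, out N' = out N & cells N' = rhs ++ rest].
Proof.
move=> pN el rl er rr uK K1.
have [|N' [i o c]] := @mk_net true (port N (s:=true)) (port N (s:=false)) (rhs ++ rest); last first.
  by exists N'; split=> //; apply/ffunP.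
move=> w; have [/= le_N eq_N] := port_count true N w.
move: le_N eq_N; rewrite !(count_nears _ pN) !nears_cat !cnt_cat.
rewrite (cnt_perm el) (cnt_perm rl) (cnt_perm er) (cnt_perm rr) !cnt_cat.
case: (boolP (w \in K')) => [wK|]; last by rewrite -cnt_eq0 => /eqP ->; lia.
have [P1 P2] := K1 w wK.
have z s : cnt w (codom (port N (s:=s))) = 0.
  apply/eqP; rewrite cnt_eq0; apply/negP => /codomP[x wx].
  by have := P2 s x; rewrite wx eqxx.
have z' s : cnt w (nears s lhs) + cnt w (nears s rest) = 0.
  by apply/eqP; rewrite -cnt_cat -nears_cat -(count_nears _ pN) cnt_eq0.
have := z' true; have := z' false; have := @cnt_uniq w _ uK.
rewrite (cnt_perm el) (cnt_perm rl) !cnt_cat !z; lia.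
Qed.

(** A threshold rather than a single name, because (ba) needs four fresh wires at once. The sum of
    all names in use bounds each of them. *)
Lemma fresh_wires N :
  exists u, forall w, u <= w -> unused N w.
Proof.
pose l := codom (inp N) ++ codom (out N) ++ nears true (cells N) ++ nears false (cells N).
exists (sumn l).+1 => w lw.
have wl : w \notin l.
  apply/negP => wl; suff : w <= sumn l by lia.
  by elim: l wl {lw} => //= a l IH; rewrite inE => /orP[/eqP ->|/IH]; lia.
move: wl; rewrite !mem_cat !negb_or => /and4P[wi wo wt wf].
split; [by case | case=> x]; apply/negP => /eqP wx.
- by move: wi; rewrite wx codom_f.
- by move: wo; rewrite wx codom_f.
Qed.

Lemma perm_cells_equiv N N' :
  inp N' = inp N -> out N' = out N -> perm_eq (cells N') (cells N) -> net_equiv N N'.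
Proof.
move=> i o c; apply: rst_step; constructor 1; exists id; split=> //.
by rewrite -[map _ _]/(rn id _) rn_id; split=> //; apply/ffunP => x; rewrite ffunE ?i ?o.
Qed.

Lemma port_ext N N' : (forall s (x : side I O s), port N' x = port N x) ->
  inp N' = inp N /\ out N' = out N.
Proof. by move=> e; split; apply/ffunP => x; [apply: (e true)|apply: (e false)]. Qed.

Lemma equiv_refl N : net_equiv N N. Proof. exact: rst_refl. Qed.
Lemma equiv_sym N N' : net_equiv N N' -> net_equiv N' N. Proof. exact: rst_sym. Qed.
Lemma equiv_trans N2 N1 N3 : net_equiv N1 N2 -> net_equiv N2 N3 -> net_equiv N1 N3.
Proof. exact: rst_trans. Qed.

(** The ports are kept exactly, so that work on the comb of one port leaves the roots of the other
    combs in place. *)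
Definition turns N C : Prop :=
  exists N', [/\ net_equiv N N', inp N' = inp N, out N' = out N & perm_eq (cells N') C].

Lemma turns_perm N C C' : turns N C -> perm_eq C C' -> turns N C'.
Proof.
by move=> [N' [e i o c]] CC; exists N'; split=> //; apply: perm_trans CC.
Qed.

Lemma turns_from N1 N C : net_equiv N N1 -> inp N1 = inp N -> out N1 = out N ->
  turns N1 C -> turns N C.
Proof.
move=> e1 i1 o1 [N2 [e2 i2 o2 p2]].
by exists N2; split=> //; [apply: equiv_trans e2|rewrite i2|rewrite o2].
Qed.

Lemma turns_refl N C : perm_eq (cells N) C -> turns N C.
Proof. by exists N; split=> //; apply: equiv_refl. Qed.

Lemma ac_turns N lhs rhs rest (K K' D A : seq wire) :
  (ac_rule lhs rhs \/ ac_rule rhs lhs) ->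
  perm_eq (cells N) (lhs ++ rest) ->
  perm_eq (nears false lhs) (K ++ D) -> perm_eq (nears true lhs) (K ++ A) ->
  perm_eq (nears false rhs) (K' ++ D) -> perm_eq (nears true rhs) (K' ++ A) ->
  uniq K' -> {in K', forall w, unused N w} ->
  turns N (rhs ++ rest).
Proof.
move=> ac pN el rl er rr uK K1.
have [N' [i o c]] := replace_cells pN el rl er rr uK K1.
exists N'; rewrite c; split=> //.
case: ac => ac; [|apply: rst_sym]; apply: rst_step; constructor 2.
- by exists lhs, rhs, rest; rewrite c.
- by exists rhs, lhs, rest; rewrite c.
Qed.

Lemma turns_comm s N a b c rest :
  perm_eq (cells N) (nd s a b c :: rest) -> turns N (nd s a c b :: rest).
Proof.
move=> pN.
apply: (@ac_turns N [:: nd s a b c] [:: nd s a c b] rest [::] [::]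
          (near false (nd s a b c)) (near true (nd s a b c))) => //.
- by left; case: s {pN}; constructor.
all: rewrite /nears /= ?cats0 //; case: s {pN} => //=.
all: by apply/permP => p /=; lia.
Qed.

Lemma turns_assoc_r s N a b c d x rest :
  perm_eq (cells N) (nd s a b x :: nd s x c d :: rest) ->
  exists y, turns N (nd s a y d :: nd s y b c :: rest).
Proof.
move=> pN; have [u fu] := fresh_wires N; exists u.
(* [contr_assoc] lists the root cell first, [cocontr_assoc] the inner cell first. *)
have {pN} pN : perm_eq (cells N)
    ((if s then [:: nd s a b x; nd s x c d] else [:: nd s x c d; nd s a b x]) ++ rest).
  apply: perm_trans pN _; case: s => //.
  by apply/permP => p /=; lia.
suff T : turns N ((if s then [:: nd s a u d; nd s u b c]
                        else [:: nd s u b c; nd s a u d]) ++ rest).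
  by apply: turns_perm T _; case: s {pN} => //; apply/permP => p /=; lia.
apply: (ac_turns _ pN (K := [:: x]) (K' := [:: u])
   (D := if s then [:: b; c; d] else [:: a]) (A := if s then [:: a] else [:: b; c; d])) => //.
- by case: s {pN}; [left|left]; constructor.
all: try by case: s {pN}; apply/permP => p /=; lia.
by move=> w; rewrite inE => /eqP ->; apply: fu.
Qed.

Lemma turns_assoc_l s N a b c d y rest :
  perm_eq (cells N) (nd s a y d :: nd s y b c :: rest) ->
  exists x, turns N (nd s a b x :: nd s x c d :: rest).
Proof.
move=> pN; have [u fu] := fresh_wires N; exists u.
have {pN} pN : perm_eq (cells N)
    ((if s then [:: nd s a y d; nd s y b c] else [:: nd s y b c; nd s a y d]) ++ rest).
  apply: perm_trans pN _; case: s => //.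
  by apply/permP => p /=; lia.
suff T : turns N ((if s then [:: nd s a b u; nd s u c d]
                        else [:: nd s u c d; nd s a b u]) ++ rest).
  by apply: turns_perm T _; case: s {pN} => //; apply/permP => p /=; lia.
apply: (ac_turns _ pN (K := [:: y]) (K' := [:: u])
   (D := if s then [:: b; c; d] else [:: a]) (A := if s then [:: a] else [:: b; c; d])) => //.
- by case: s {pN}; [right|right]; constructor.
all: try by case: s {pN}; apply/permP => p /=; lia.
by move=> w; rewrite inE => /eqP ->; apply: fu.
Qed.

End Nets.

Arguments port : simpl never.

(** * Labellings *)

(* [phi] counts, with multiplicity, the directed paths reaching a wire from the
   inputs weighted by [vin]; for [e = 1] it counts those from the coweakenings
   and cocontractions as well.  [rho] witnesses the absence of directed
   cycles. *)
Definition constraint (e : nat) (phi rho : wire -> nat) (c : cell) : Prop :=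
  match c with
  | Weak _ => True
  | Coweak a => phi a = e
  | Contr a b c => [/\ phi b = phi a, phi c = phi a, rho a < rho b & rho a < rho c]
  | Cocontr a b c => [/\ phi c = phi a + phi b + e, rho a < rho c & rho b < rho c]
  end.

Definition labelling (I O : finType) (e : nat) (vin : I -> nat) (r : O -> nat)
    (phi rho : wire -> nat) (N : net I O) : Prop :=
  [/\ forall i, phi (inp N i) = vin i, forall o, phi (out N o) = r o &
      forall c, c \in cells N -> constraint e phi rho c].

Definition labelled (I O : finType) (e : nat) (vin : I -> nat) (r : O -> nat)
    (N : net I O) : Prop :=
  exists phi rho, labelling e vin r phi rho N.

Definition work (phi : wire -> nat) (C : seq cell) : nat :=
  sumn [seq if kind c then phi (principal c) else 0 | c <- C].

Lemma work_perm phi C C' : perm_eq C C' -> work phi C = work phi C'.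
Proof. by move=> CC; apply/perm_sumn/perm_map. Qed.

Lemma work_cat phi C C' : work phi (C ++ C') = work phi C + work phi C'.
Proof. by rewrite /work map_cat sumn_cat. Qed.

(** Doubling the ranks frees an odd value next to each of them for the wires that a transformation
    creates. A received wire may take that value itself, since [rho a < rho b] gives
    [(rho a).*2.+1 < (rho b).*2]. *)
Lemma constraint_double e phi rho phi' rho' c :
  (forall w s, w \in near s c -> phi' w = phi w /\
     (if s return Prop then rho' w <= (rho w).*2.+1 else rho' w = (rho w).*2)) ->
  constraint e phi rho c -> constraint e phi' rho' c.
Proof.
move=> h; have hr w : w \in received c -> phi' w = phi w /\ rho' w <= (rho w).*2.+1.
  exact: (h w true).
have {h}he w : w \in emitted c -> phi' w = phi w /\ rho' w = (rho w).*2.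
  exact: (h w false).
case: c hr he => [a|a|a b c|a b c] //= hr he.
- by have [|-> _] := he a; first by rewrite inE.
- have [|-> ra] := hr a; first by rewrite inE.
  have [|-> ->] := he b; first by rewrite !inE eqxx.
  have [|-> ->] := he c; first by rewrite !inE eqxx orbT.
  by case=> *; split=> //; lia.
- have [|-> ra] := hr a; first by rewrite !inE eqxx.
  have [|-> rb] := hr b; first by rewrite !inE eqxx orbT.
  have [|-> ->] := he c; first by rewrite inE.
  by case=> *; split=> //; lia.
Qed.

Section Labels.
Variables (I O : finType) (vin : I -> nat) (r : O -> nat).
Implicit Types (N : net I O) (s : bool) (C : seq cell).

Lemma uniq_nears N C rest s : perm_eq (cells N) (C ++ rest) -> uniq (nears s C).
Proof.
move=> pN; apply: uniq_cnt => w; have [] := port_count (~~ s) N w.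
by rewrite negbK (count_nears _ pN) nears_cat cnt_cat; lia.
Qed.

(** A wire of [K] both starts and ends inside [rhs], so by linearity it occurs neither at a port nor
    in [rest], and its labels can be chosen freely. *)
Lemma labelling_replace e phi rho phi' rho' N N' lhs rhs rest (K : seq wire) :
  labelling e vin r phi rho N ->
  inp N' = inp N -> out N' = out N ->
  perm_eq (cells N) (lhs ++ rest) -> perm_eq (cells N') (rhs ++ rest) ->
  (forall w s, w \in K -> w \in nears s rhs) ->
  (forall w, w \notin K -> phi' w = phi w /\ rho' w = (rho w).*2) ->
  (forall c, c \in rhs -> constraint e phi' rho' c) ->
  labelling e vin r phi' rho' N' /\ work phi' rest = work phi rest.
Proof.
move=> [li lo lc] ei eo pN pN' Krhs agree rhsC.
have K_port w s (x : side I O s) : w \in K -> w != port N' x.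
  move=> wK; apply/eqP => wx; have [] := port_count s N' w.
  rewrite (count_nears _ pN') nears_cat !cnt_cat.
  have := Krhs w (~~ s) wK; have : w \in codom (port N' (s:=s)) by rewrite wx codom_f.
  by rewrite -!cnt_gt0; lia.
have K_rest w s : w \in K -> w \notin nears s rest.
  move=> wK; have [] := port_count (~~ s) N' w.
  rewrite negbK (count_nears _ pN') nears_cat !cnt_cat.
  by have := Krhs w s wK; rewrite -cnt_gt0 -cnt_eq0; lia.
have agree_rest w s : w \in nears s rest -> phi' w = phi w /\ rho' w = (rho w).*2.
  by move=> wr; apply: agree; apply/negP => /(K_rest _ s); rewrite wr.
split; [split|].
- move=> i; rewrite -li -ei; apply: (proj1 (agree _ _)); apply/negP => /(K_port _ true i).
  by rewrite eqxx.
- move=> o; rewrite -lo -eo; apply: (proj1 (agree _ _)); apply/negP => /(K_port _ false o).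
  by rewrite eqxx.
- move=> c; rewrite (perm_mem pN') mem_cat => /orP[/rhsC //|cr].
  apply: (@constraint_double e phi rho).
    by move=> w s wc; have [-> ->] := agree_rest w s (mem_nears cr wc); case: (s).
  by apply: lc; rewrite (perm_mem pN) mem_cat cr orbT.
- congr sumn; apply/eq_in_map => c cr; case: ifP => // kc.
  apply: (proj1 (agree_rest _ true _)).
  by apply: (mem_nears cr); move: kc; case: (c) => //= *; rewrite inE.
Qed.

Local Ltac neq_split := repeat match goal with
  | H : is_true (_ && _) |- _ => let H1 := fresh in let H2 := fresh in
      move/andP: H => [H1 H2]
  end.
Local Ltac neq_simpl := repeat match goal with
  | H : is_true (?x != ?y) |- _ =>
      rewrite ?(negPf H) ?(eq_sym y x) ?(negPf H); clear H
  end.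

(** One computation serves two purposes: [e = 0] gives the invariance of the path counts, [e = 1]
    the strict decrease behind termination. *)
Lemma labelling_step e phi rho N N' :
  labelling e vin r phi rho N -> step N N' ->
  exists phi' rho', labelling e vin r phi' rho' N' /\
    work phi' (cells N') + e = work phi (cells N).
Proof.
move=> L [lhs [rhs [rest [rl [ei eo pN pN']]]]].
have lhsC c : c \in lhs -> constraint e phi rho c.
  by case: L => _ _ lc cl; apply: lc; rewrite (perm_mem pN) mem_cat cl.
have uf := uniq_nears false pN'; have ut := uniq_nears true pN'.
rewrite (work_perm phi pN) work_cat.
have conclude (K : seq wire) phi' rho' : (forall w s, w \in K -> w \in nears s rhs) ->
    (forall w, w \notin K -> phi' w = phi w /\ rho' w = (rho w).*2) ->
    (forall c, c \in rhs -> constraint e phi' rho' c) ->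
    work phi' rhs + e = work phi lhs ->
    exists phi' rho', labelling e vin r phi' rho' N' /\
      work phi' (cells N') + e = work phi lhs + work phi rest.
  move=> h1 h2 h3 h4; exists phi', rho'.
  have [L' wr] := labelling_replace L ei eo pN pN' h1 h2 h3.
  by split=> //; rewrite (work_perm phi' pN') work_cat wr; lia.
case: rl pN pN' lhsC uf ut conclude => [a b c d f w x y z|c d f|a b c|c] pN pN' lhsC uf ut conclude.
- have [hc ac bc] := lhsC (Cocontr a b c) (mem_head _ _).
  have [hd hf cd cf] := lhsC (Contr c d f) (mem_last _ [:: _]).
  move: uf ut; rewrite /nears /= !inE !negb_or => uf ut.
  (* [w] and [x] are copies of [a], while [y] and [z] are copies of [b]; their odd ranks lie
     strictly between those of their source and of [d] and [f]. *)
  apply: (conclude [:: w; x; y; z]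
    (fun v => if v \in [:: w; x] then phi a else if v \in [:: y; z] then phi b else phi v)
    (fun v => if v \in [:: w; x] then (rho a).*2.+1
              else if v \in [:: y; z] then (rho b).*2.+1 else (rho v).*2)).
  + move=> v s; rewrite !inE.
    by case: s => /=; case/or4P => /eqP ->; rewrite /nears /= !inE eqxx ?orbT.
  + move=> v; rewrite !inE !negb_or => /and4P[h1 h2 h3 h4].
    by rewrite (negPf h1) (negPf h2) (negPf h3) (negPf h4).
  + neq_split; move=> k; rewrite !inE => /or4P[] /eqP -> /=; rewrite !inE ?eqxx ?orbT;
      neq_simpl; rewrite /=; split=> //; lia.
  + rewrite /work /= !inE; neq_split; neq_simpl; rewrite /=; lia.
- have hc := lhsC (Coweak c) (mem_head _ _).
  have [hd hf cd cf] := lhsC (Contr c d f) (mem_last _ [:: _]).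
  apply: (conclude [::] phi (fun v => (rho v).*2)) => //.
    by move=> k; rewrite !inE => /orP[] /eqP ->; rewrite /= ?hd ?hf.
  by rewrite /work /= hc; lia.
- have [hc ac bc] := lhsC (Cocontr a b c) (mem_head _ _).
  apply: (conclude [::] phi (fun v => (rho v).*2)) => //.
    by move=> k; rewrite !inE => /orP[] /eqP ->.
  by rewrite /work /= hc; lia.
- have hc := lhsC (Coweak c) (mem_head _ _).
  apply: (conclude [::] phi (fun v => (rho v).*2)) => //.
  by rewrite /work /= hc; lia.
Qed.

(** * Invariance of valuations under equivalence *)

Lemma labelled_ac N N' : rewrites ac_rule N N' ->
  labelled 0 vin r N <-> labelled 0 vin r N'.
Proof.
move=> [lhs [rhs [rest [ac [ei eo pN pN']]]]].
have conclude M M' l l' : inp M' = inp M -> out M' = out M ->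
    perm_eq (cells M) (l ++ rest) -> perm_eq (cells M') (l' ++ rest) ->
    (forall phi rho, (forall c, c \in l -> constraint 0 phi rho c) ->
     exists (K : seq wire) phi' rho', [/\ forall w s, w \in K -> w \in nears s l',
    forall w, w \notin K -> phi' w = phi w /\ rho' w = (rho w).*2 &
    forall c, c \in l' -> constraint 0 phi' rho' c]) ->
    labelled 0 vin r M -> labelled 0 vin r M'.
  move=> mi mo pM pM' h [phi [rho L]].
  have [|K [phi' [rho' [h1 h2 h3]]]] := h phi rho.
    by move=> c cl; case: L => _ _; apply; rewrite (perm_mem pM) mem_cat cl.
  by exists phi', rho'; have [] := labelling_replace L mi mo pM pM' h1 h2 h3.
have uf := uniq_nears false pN; have ut := uniq_nears true pN.
have uf' := uniq_nears false pN'; have ut' := uniq_nears true pN'.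
case: ac pN pN' uf ut uf' ut' => [a b c d x y|a b c|a b c d x y|a b c] pN pN' uf ut uf' ut'.
- move: uf ut uf' ut'; rewrite /nears /= !inE !negb_or => uf ut uf' ut'; split.
  + apply: (conclude _ _ _ _ ei eo pN pN') => phi rho C.
    have [h1 h2 h3 h4] := C (Contr a b x) (mem_head _ _).
    have [h1' h2' h3' h4'] := C (Contr x c d) (mem_last _ [:: _]).
    exists [:: y], (fun v => if v == y then phi a else phi v),
      (fun v => if v == y then (rho a).*2.+1 else (rho v).*2); split.
    * by move=> w s; rewrite inE => /eqP ->; case: s; rewrite /nears /= !inE eqxx ?orbT.
    * by move=> w; rewrite inE => /negPf ->.
    * neq_split; move=> k; rewrite !inE => /orP[] /eqP -> /=; rewrite ?eqxx;
      neq_simpl; split=> //; lia.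
  + apply: (conclude _ _ _ _ (esym ei) (esym eo) pN' pN) => phi rho C.
    have [h1 h2 h3 h4] := C (Contr a y d) (mem_head _ _).
    have [h1' h2' h3' h4'] := C (Contr y b c) (mem_last _ [:: _]).
    exists [:: x], (fun v => if v == x then phi a else phi v),
      (fun v => if v == x then (rho a).*2.+1 else (rho v).*2); split.
    * by move=> w s; rewrite inE => /eqP ->; case: s; rewrite /nears /= !inE eqxx ?orbT.
    * by move=> w; rewrite inE => /negPf ->.
    * neq_split; move=> k; rewrite !inE => /orP[] /eqP -> /=; rewrite ?eqxx;
      neq_simpl; split=> //; lia.
- split; [apply: (conclude _ _ _ _ ei eo pN pN')
         |apply: (conclude _ _ _ _ (esym ei) (esym eo) pN' pN)] => phi rho C;
    have [h1 h2 h3 h4] := C _ (mem_head _ _);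
    exists [::], phi, (fun v => (rho v).*2); split=> // k; rewrite inE => /eqP -> /=;
    split=> //; lia.
- move: uf ut uf' ut'; rewrite /nears /= !inE !negb_or => uf ut uf' ut'; split.
  + apply: (conclude _ _ _ _ ei eo pN pN') => phi rho C.
    have [h1 h2 h3] := C (Cocontr b c x) (mem_head _ _).
    have [h1' h2' h3'] := C (Cocontr a x d) (mem_last _ [:: _]).
    (* The new wire must rank above both [a] and [b], which are not comparable; the odd value just
       below the doubled rank of their common successor [d] achieves this. *)
    exists [:: y], (fun v => if v == y then phi a + phi b else phi v),
      (fun v => if v == y then (rho d).*2.-1 else (rho v).*2); split.
    * by move=> w s; rewrite inE => /eqP ->; case: s; rewrite /nears /= !inE eqxx ?orbT.
    * by move=> w; rewrite inE => /negPf ->.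
    * neq_split; move=> k; rewrite !inE => /orP[] /eqP -> /=; rewrite ?eqxx;
      neq_simpl; split=> //; lia.
  + apply: (conclude _ _ _ _ (esym ei) (esym eo) pN' pN) => phi rho C.
    have [h1 h2 h3] := C (Cocontr a b y) (mem_head _ _).
    have [h1' h2' h3'] := C (Cocontr y c d) (mem_last _ [:: _]).
    exists [:: x], (fun v => if v == x then phi b + phi c else phi v),
      (fun v => if v == x then (rho d).*2.-1 else (rho v).*2); split.
    * by move=> w s; rewrite inE => /eqP ->; case: s; rewrite /nears /= !inE eqxx ?orbT.
    * by move=> w; rewrite inE => /negPf ->.
    * neq_split; move=> k; rewrite !inE => /orP[] /eqP -> /=; rewrite ?eqxx;
      neq_simpl; split=> //; lia.
- split; [apply: (conclude _ _ _ _ ei eo pN pN')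
         |apply: (conclude _ _ _ _ (esym ei) (esym eo) pN' pN)] => phi rho C;
    have [h1 h2 h3] := C _ (mem_head _ _);
    exists [::], phi, (fun v => (rho v).*2); split=> // k; rewrite inE => /eqP -> /=;
    split=> //; lia.
Qed.

End Labels.

Section Invariance.
Variables (I O : finType) (vin : I -> nat) (r : O -> nat).
Implicit Types (N : net I O) (s : bool) (C : seq cell).

Lemma constraint_rename e phi rho f c :
  constraint e phi rho (rename f c) = constraint e (phi \o f) (rho \o f) c.
Proof. by case: c. Qed.

Lemma labelled_alpha e N N' : alpha N N' -> labelled e vin r N <-> labelled e vin r N'.
Proof.
move=> [f [injf [fi fo fc]]]; split=> [] [phi [rho [li lo lc]]].
(* [f] is injective but possibly not surjective, so it is inverted only on the wires in use. *)
- pose W := codom (inp N) ++ codom (out N) ++ nears true (cells N) ++ nears false (cells N).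
  pose g v := nth 0 W (index v (map f W)).
  have fK w : w \in W -> g (f w) = w by move=> wW; rewrite /g index_map // nth_index.
  exists (phi \o g), (fun v => (rho (g v)).*2); split.
  + by move=> i; rewrite fi ffunE /= fK ?li // !mem_cat codom_f.
  + by move=> o; rewrite fo ffunE /= fK ?lo // !mem_cat codom_f orbT.
  + move=> c'; rewrite (perm_mem fc) => /mapP[c cN ->].
    rewrite constraint_rename; apply: constraint_double (lc _ cN) => w s wc.
    have wW : w \in W.
      by have := mem_nears cN wc; rewrite !mem_cat; case: (s) => ->; rewrite !orbT.
    by rewrite /= fK //; case: (s).
- exists (phi \o f), (rho \o f); split.
  + by move=> i; rewrite -li fi ffunE.
  + by move=> o; rewrite -lo fo ffunE.
  + move=> c cN; rewrite -constraint_rename; apply: lc.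
    by rewrite (perm_mem fc) map_f.
Qed.

(** The value [e = 0] is essential: a coweakening must contribute nothing to the cocontraction that
    it feeds. *)
Lemma labelled_neutrality N N' : neutrality N N' ->
  labelled 0 vin r N <-> labelled 0 vin r N'.
Proof.
move=> [lhs [rest [a [b [[nr ab pN] [ei eo pN']]]]]].
have cntN s w := port_count s N w.
have lhsP : exists2 c : wire, perm_eq (nears true lhs) [:: a; c] &
    perm_eq (nears false lhs) [:: b; c].
  by case: nr {pN pN' eo ab} => {}a {}b c; exists c.
have [c cr ce] := lhsP.
have [bc ac] : b != c /\ a != c.
  have /= := cntN true c; rewrite !(count_nears _ pN) !nears_cat !cnt_cat.
  rewrite (cnt_perm cr) (cnt_perm ce) !cnt_cons eqxx.
  by case: eqP; case: eqP; lia.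
have c_rest s : c \notin nears s rest.
  rewrite -cnt_eq0; have /= := cntN true c; have /= := cntN false c.
  rewrite !(count_nears _ pN) !nears_cat !cnt_cat (cnt_perm cr) (cnt_perm ce).
  by rewrite !cnt_cons eqxx; case: s; lia.
have b_rest : b \notin nears false rest.
  rewrite -cnt_eq0; have /= := cntN true b.
  by rewrite !(count_nears _ pN) !nears_cat !cnt_cat (cnt_perm ce) !cnt_cons eqxx; lia.
have c_port s x : port N (s:=s) x != c.
  apply/eqP => xc; have := cntN s c; have := cntN (~~ s) c.
  have : 0 < cnt c (codom (port N (s:=s))) by rewrite cnt_gt0 -xc codom_f.
  rewrite !(count_nears _ pN) !nears_cat !cnt_cat.
  by case: s x {xc} => x /=; rewrite ?(cnt_perm cr) ?(cnt_perm ce) !cnt_cons eqxx; lia.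
have b_inp i : inp N i != b.
  apply/eqP => ib; have /= := cntN true b.
  have : 0 < cnt b (codom (port N (s:=true))) by rewrite cnt_gt0 -ib (codom_f (port N (s:=true))).
  by rewrite !(count_nears _ pN) !nears_cat !cnt_cat (cnt_perm ce) !cnt_cons eqxx; lia.
split=> [] [phi [rho [li lo lc]]].
- have [phiab rhoab] : phi a = phi b /\ rho a < rho b.
    have lhsC k : k \in lhs -> constraint 0 phi rho k.
      by move=> kl; apply: lc; rewrite (perm_mem pN) mem_cat kl.
    case: nr lhsC {pN lhsP cr ce ab b_inp b_rest bc ac eo pN'} => a' b' c' lhsC.
      by have [-> _ ? _] := lhsC _ (mem_head _ _).
    have [h1 h2 _] := lhsC _ (mem_head _ _).
    by have := lhsC _ (mem_last _ [:: _]); rewrite /= h1 => ->; split=> //; lia.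
  have phif w : phi (fuse a b w) = phi w by rewrite /fuse; case: eqP => [->|].
  exists phi, (fun w => (rho w).*2); split=> [i|o|k'].
  + by rewrite ei.
  + by rewrite eo ffunE phif.
  + rewrite (perm_mem pN') => /mapP[k kr ->]; rewrite constraint_rename.
    have := lc k; rewrite (perm_mem pN) mem_cat kr orbT => /(_ isT).
    apply: constraint_double => w s wk; rewrite /= phif; split=> //.
    have := mem_nears kr wk; rewrite /fuse; case: (w =P b) => [->|_]; case: (s) => //.
      by move=> _; lia.
    by move/negP: b_rest.
(* [cp] and [cr'] label the wire [c] that this direction creates: after a contraction it copies [a],
   before a cocontraction it comes from a coweakening and gets value and rank [0]. *)
- pose cp := if lhs is Contr _ _ _ :: _ then phi a else 0.
  pose cr' := if lhs is Contr _ _ _ :: _ then (rho a).*2.+1 else 0.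
  exists (fun w => if w == b then phi a else if w == c then cp else phi w),
    (fun w => if w == b then (rho a).*2.+1 else if w == c then cr' else (rho w).*2).
  split=> [i|o|k].
  + by rewrite (negPf (b_inp i)) (negPf (c_port true i)) -li ei.
  + rewrite -lo eo ffunE /fuse (negPf (c_port false o)).
    by case: eqP.
  + rewrite (perm_mem pN) mem_cat => /orP[kl|kr].
      case: nr @cp @cr' ab bc ac lhsP cr ce kl {pN pN' b_rest b_inp eo c_rest c_port lc}
        => {}a {}b c' cp cr' ab bc ac _ cr ce; rewrite !inE => /orP[] /eqP -> //=;
        (have -> : c' = c by
           have := perm_mem ce c'; rewrite !inE eqxx orbT => /esym /orP[] /eqP // cb;
           have := perm_uniq ce; rewrite /= !inE bc cb eqxx);
        rewrite ?eqxx ?(negPf ab) ?(eq_sym c b) ?(negPf bc) ?(negPf ac) /cp /cr'.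
    - by split=> //; lia.
    - by split=> //; lia.
    - by [].
    have := lc (rename (fuse a b) k); rewrite (perm_mem pN') map_f // => /(_ isT).
    rewrite constraint_rename; apply: constraint_double => w s wk.
    have wr := mem_nears kr wk.
    have wc : w != c by apply: contraNneq (c_rest s) => <-.
    rewrite /= /fuse (negPf wc); case: (w =P b) wr => [->|_ _]; case: (s) => //=.
    by move=> br; rewrite br in b_rest.
Qed.

Lemma labelled_equiv N N' : net_equiv N N' -> labelled 0 vin r N <-> labelled 0 vin r N'.
Proof.
elim=> {N N'} [N N' [al|ac|ne]|N|N N' _ IH|N1 N2 N3 _ IH1 _ IH2].
- exact: labelled_alpha.
- exact: labelled_ac.
- exact: labelled_neutrality.
- by [].
- by symmetry.
- by rewrite IH1.
Qed.

Lemma labelled_reduces N N' : reduces N N' -> labelled 0 vin r N -> labelled 0 vin r N'.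
Proof.
elim=> {N N'} [N N' [/labelled_equiv -> //|st]|//|N1 N2 N3 _ IH1 _ IH2 /IH1 //].
by case=> phi [rho L]; have [phi' [rho' [L' _]]] := labelling_step L st; exists phi', rho'.
Qed.

End Invariance.

(** * From correctness to valuations *)

Section Correct.
Variables (I O : finType).
Implicit Types (N : net I O) (s : bool) (C : seq cell).

Lemma uniq_nears_cells N s : uniq (nears s (cells N)).
Proof. by apply: (@uniq_nears _ _ N (cells N) [::]); rewrite cats0. Qed.

Lemma uniq_cells N : uniq (cells N).
Proof.
have := uniq_nears_cells N; elim: (cells N) => //= c C IH uN; apply/andP; split.
  apply/negP => cC; have := uN (kind c); rewrite nears_cons near_kind /=.
  by rewrite (mem_nears cC) // near_kind inE.
by apply: IH => s; have := uN s; rewrite nears_cons cat_uniq => /and3P[].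
Qed.

Lemma near_inj N s c c' w : c \in cells N -> c' \in cells N ->
  w \in near s c -> w \in near s c' -> c = c'.
Proof.
move=> cN c'N wc wc'; apply/eqP/negPn/negP => cc.
have pN := perm_to_rem cN.
have c'r : c' \in rem c (cells N).
  by move: c'N; rewrite (perm_mem pN) inE eq_sym (negPf cc).
have := cnt_uniq w (uniq_nears_cells N s); rewrite (count_nears _ pN) nears_cons cnt_cat.
by have := mem_nears c'r wc'; move: wc; rewrite -!cnt_gt0; lia.
Qed.

Lemma uniq_near N s c : c \in cells N -> uniq (near s c).
Proof.
move=> /perm_to_rem pN; have := uniq_nears_cells N s.
by rewrite (perm_uniq (perm_nears s pN)) nears_cons cat_uniq => /andP[].
Qed.

(** The orbit of [ord0] enters a loop; taking the least positive period there makes the trajectory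
    free of repetitions, which [acyclic] asks of a walk. *)
Lemma cyclic_iter n (f : 'I_n.+1 -> 'I_n.+1) :
  exists x m, iter m.+1 f x = x /\ uniq (traject f x m.+1).
Proof.
have /trajectP[i lt_i ei] := fingraph.looping_order f ord0.
set x := iter i f ord0 in ei.
have ex : exists m, (0 < m) && (iter m f x == x).
  exists (fingraph.order f ord0 - i); rewrite subn_gt0 lt_i -iterD.
  by rewrite subnK ?(ltnW lt_i) // ei eqxx.
case: (ex_minnP ex) => [[|m]] // /andP[_ /eqP mx] min_m; exists x, m; split=> //.
rewrite looping_uniq; apply/negP => /trajectP[j lt_j ej].
by have := min_m j.+1; rewrite iterS -ej -iterS mx eqxx => /(_ isT); lia.
Qed.

(** Otherwise every cell of [C] emits a wire received in [C], and following one chosen wire per cell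
    runs into a directed cycle. As each contraction is left through its single chosen wire, one
    switching keeps all chosen wires attached, and the cycle contradicts correctness. *)
Lemma maximal_cell N C : routing_net N -> uniq C -> {subset C <= cells N} -> C != [::] ->
  exists2 c, c \in C &
    forall c' w, c' \in C -> w \in emitted c -> w \notin received c'.
Proof.
move=> corr uC CN; case eC: C => [//|c0 C'] _; rewrite -eC; apply: NNPP => noc.
have szC : size C = (size C').+1 by rewrite eC.
pose cl (i : 'I_(size C').+1) := nth c0 C i.
have clC i : cl i \in C by rewrite mem_nth // eC ltn_ord.
have clN i : cl i \in cells N by apply: CN.
have ex_next i : exists u : 'I_(size C').+1 * wire,
    u.2 \in emitted (cl i) /\ u.2 \in received (cl u.1).
  apply: NNPP => noj; apply: noc; exists (cl i) => //.
  move=> c' w c'C wi; apply/negP => wc'; apply: noj.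
  have lt_c' : index c' C < (size C').+1.
    by move: c'C; rewrite -index_mem {2}eC.
  by exists (Ordinal lt_c', w); rewrite /= /cl /= nth_index.
have [next nextP] := fin_all_exists ex_next.
pose f i := (next i).1; pose wi i := (next i).2.
have wi_inj i j : wi i \in emitted (cl j) -> i = j.
  move=> wij; have [wii _] := nextP i.
  have /eqP := @near_inj N false _ _ _ (clN i) (clN j) wii wij.
  by rewrite nth_uniq ?szC ?ltn_ord // => /eqP /val_inj.
(* The value [true] detaches the second auxiliary wire, hence it is taken when the first one is
   chosen. *)
pose sw (c : cell) := if c is Contr _ b _ then b \in codom wi else false.
have attached i : detached sw (cl i) (wi i) = false.
  have := uniq_near false (clN i).
  have [wii _] := nextP i; have := wi_inj^~ i; move: wii; rewrite -/(wi i).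
  case: (cl i) => //= a b d; rewrite !inE andbT => wii inj nbd.
  have [bw|bw] := boolP (b \in codom wi).
    have /codomP[j bj] := bw; have ji : j = i by apply: inj; rewrite !inE -bj eqxx.
    by rewrite -ji -bj (negPf nbd).
  by apply: contraNF bw => /eqP <-; apply: codom_f.
have walk_traject k i :
    walk sw N (VCell I O (cl i)) (map wi (traject f i k)) (VCell I O (cl (iter k f i))).
  elim: k i => [|k IH] i; first exact: WalkNil.
  rewrite trajectS iterSr /=; apply: WalkCons (IH (f i)); left.
  have [ei ri] := nextP i; split; last exact: EndCell.
  by have := StartCell sw (clN i) ei; rewrite attached.
have [x [m [mx uniq_x]]] := cyclic_iter f.
have := corr sw (VCell I O (cl x)) (map wi (traject f x m.+1)).
rewrite map_inj_uniq; last first.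
  by move=> i j eij; apply: wi_inj; rewrite eij; have [] := nextP j.
by move=> /(_ uniq_x) cyc; have := walk_traject m.+1 x; rewrite mx => /cyc.
Qed.

(** Stated for subsets of the cells to allow induction: a cell whose emitted wires feed no cell of
    [C] is labelled last, so that its new values disturb no constraint already met. *)
Lemma labelling_exists e (vin : I -> nat) N C :
  routing_net N -> uniq C -> {subset C <= cells N} ->
  exists phi rho, (forall i, phi (inp N i) = vin i) /\
    forall c, c \in C -> constraint e phi rho c.
Proof.
move=> corr; have [k] := ubnP (size C); elim: k C => // k IH C.
case: (eqVneq C [::]) => [-> _ _ _|C0 lt_k uC CN].
  exists (fun w => if [pick i | inp N i == w] is Some i then vin i else 0), (fun=> 0).
  split=> // i; case: pickP => [j /eqP ij|/(_ i)]; last by rewrite eqxx.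
  congr vin; apply: (injectiveP (inp N)) ij.
  by have [] := port_linear true N; rewrite cat_uniq => /andP[].
have [c cC maxc] := maximal_cell corr uC CN C0.
have pC := perm_to_rem cC.
have [|||phi [rho [hi hc]]] := IH (rem c C).
- by move: lt_k; rewrite (perm_size pC).
- exact: rem_uniq.
- by move=> c' /mem_rem /CN.
pose val := match c with
  | Coweak _ => e | Contr a _ _ => phi a | Cocontr a b _ => phi a + phi b + e
  | Weak _ => 0 end.
exists (fun w => if w \in emitted c then val else phi w),
  (* The sum dominates the rank of each received wire; the other ranks are doubled to fit
     [constraint_double]. *)
  (fun w => if w \in emitted c then (sumn (map rho (received c))).+1.*2 else (rho w).*2).
split=> [i|c'].
  rewrite -hi ifN //; apply/negP => ic.
  have := port_count true N (inp N i); have /= := mem_nears (s:=false) (CN _ cC) ic.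
  rewrite -cnt_gt0; have : inp N i \in codom (port N (s:=true)).
    exact: (codom_f (port N (s:=true))).
  by rewrite -cnt_gt0; lia.
rewrite (perm_mem pC) inE => /orP[/eqP ->|c'C].
  have := maxc c ^~ cC; rewrite /val; case: (c) => [a|a|a b d|a b d] //= h.
  - by rewrite inE eqxx.
  - have /negPf -> : a \notin [:: b; d].
      by apply/negP => /(h a); rewrite inE eqxx.
    by rewrite !inE !eqxx orbT /=; split=> //; lia.
  - have /negPf -> : a \notin [:: d].
      by apply/negP => /(h a); rewrite inE eqxx.
    have /negPf -> : b \notin [:: d].
      by apply/negP => /(h b); rewrite !inE eqxx orbT.
    rewrite !inE !eqxx.
    by split=> //=; lia.
apply: constraint_double (hc _ c'C) => w s wc'.
have /negPf -> : w \notin emitted c; last by case: (s).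
apply/negP => wc; have c'C' := mem_rem c'C; case: s wc' => wc'.
  by have := maxc c' w c'C' wc; rewrite wc'.
have cc' := @near_inj N false _ _ _ (CN _ cC) (CN _ c'C') wc wc'.
by move: c'C; rewrite -cc' mem_rem_uniqF.
Qed.

Lemma routing_labelled e (vin : I -> nat) N :
  routing_net N -> exists r, labelled e vin r N.
Proof.
move=> corr.
have [//|phi [rho [hi hc]]] := labelling_exists e vin corr (uniq_cells N).
by exists (fun o => phi (out N o)), phi, rho.
Qed.

(** * Normal nets *)

Lemma normalizes vin r N : labelled 1 vin r N ->
  exists N', reduces N N' /\ normal N'.
Proof.
move=> [phi [rho L]]; have [n] := ubnP (work phi (cells N)).
elim: n N phi rho L => // n IH N phi rho L lt_n.
case: (classic (normal N)) => [nN|]; first by exists N; split=> //; apply: rt_refl.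
move=> /not_all_ex_not[N1 /NNPP st].
have [phi1 [rho1 [L1 w1]]] := labelling_step L st.
have [|N2 [r2 n2]] := IH _ _ _ L1; first by lia.
by exists N2; split=> //; apply: rt_trans r2; apply: rt_step; right.
Qed.

(** Each of the four combinations of facing cells is the left-hand side of a rule, and fresh names
    for (ba) make the reduct a linear net. *)
Lemma normal_facing N c c' : normal N -> c \in cells N -> c' \in cells N ->
  kind c -> ~~ kind c' -> principal c != principal c'.
Proof.
move=> nN cN c'N kc kc'; apply/eqP => cc'.
have pN : exists rest, perm_eq (cells N) ([:: c'; c] ++ rest).
  exists (rem c (rem c' (cells N))); apply: perm_trans (perm_to_rem c'N) _.
  rewrite /= perm_cons; apply: perm_to_rem.
  move: cN; rewrite (perm_mem (perm_to_rem c'N)) inE => /orP[/eqP ec|//].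
  by move: kc'; rewrite -ec kc.
have [rest {}pN] := pN; have [u fu] := fresh_wires N.
have build rhs (K' D A : seq wire) : reduction_rule [:: c'; c] rhs ->
    perm_eq (nears false [:: c'; c]) (principal c :: D) ->
    perm_eq (nears true [:: c'; c]) (principal c :: A) ->
    perm_eq (nears false rhs) (K' ++ D) -> perm_eq (nears true rhs) (K' ++ A) ->
    uniq K' -> {in K', forall w, u <= w} -> False.
  move=> rl el ll er lr uK hK.
  have [|N' [i o cN']] := @replace_cells _ _ _ _ _ _ [:: principal c] K' D A pN el ll er lr uK.
    by move=> w /hK; apply: fu.
  by apply: (nN N'); exists [:: c'; c], rhs, rest; rewrite cN'.
case: c kc cc' {cN pN} build => // [p|p a b] _;
  case: c' kc' {c'N} => // [p'|a' b' p'] _ /= -> build.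
- by apply: (build [::] [::] [::] [::]); first constructor.
- by apply: (build _ [::] [::] [:: a'; b'] (rule_s2 a' b' p')); rewrite /nears //=;
    apply/permP => q /=; lia.
- by apply: (build _ [::] [:: a; b] [::] (rule_s1 p' a b)); rewrite /nears //=;
    apply/permP => q /=; lia.
- apply: (build _ [:: u; u.+1; u.+2; u.+3] [:: a; b] [:: a'; b']
    (rule_ba a' b' p' a b u u.+1 u.+2 u.+3)); rewrite /nears /=;
    try by apply/permP => q /=; lia.
  + by rewrite !inE; lia.
  + by move=> w; rewrite !inE; lia.
Qed.


End Correct.

(** * Erasing and inserting identities *)

Lemma cnt_fuse a b w s : a != b ->
  cnt w (map (fuse a b) s) = if w == b then 0 else cnt w s + (w == a) * cnt b s.
Proof.
move=> ab; elim: s => [|v s IH]; first by rewrite /= /cnt /=; case: ifP; lia.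
rewrite /= !cnt_cons IH /fuse; case: (v =P b) => [->|/eqP vb] /=.
  case: (w =P b) => [->|/eqP wb]; first by rewrite (negPf ab).
  by rewrite (eq_sym w) (eq_sym b) (negPf wb); case: (a == w); lia.
by case: (w =P b) => [->|_]; rewrite ?(negPf vb) //; lia.
Qed.

(** Unlike [fuse], this is injective, hence a renaming that [alpha] accepts. *)
Definition swap (a b w : wire) : wire := if w == a then b else if w == b then a else w.

Lemma swapK a b : involutive (swap a b).
Proof.
move=> w; rewrite /swap; case: (w =P a) => [->|/eqP wa].
  by rewrite eqxx; case: eqP.
by case: (w =P b) => [->|/eqP wb]; rewrite ?eqxx // (negPf wa) (negPf wb).
Qed.

Lemma cnt_swap a b w s : cnt w (map (swap a b) s) = cnt (swap a b w) s.
Proof.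
rewrite /cnt count_map; apply: eq_count => v /=.
by rewrite -(inj_eq (can_inj (swapK a b))) swapK.
Qed.

Lemma codom_comp (X : finType) (f : wire -> wire) (p : X -> wire) :
  codom (fun x => f (p x)) = map f (codom p).
Proof. by rewrite !codomE -map_comp. Qed.

Ltac perm_lia := apply/permP => ?;
  rewrite ?(count_cat, map_cat, flatten_cat) /= ?(count_cat, map_cat, flatten_cat) /=; lia.

Section Identities.
Variables (I O : finType).
Implicit Types (N : net I O) (s : bool) (C : seq cell).

Lemma rename_net N f : injective f -> exists N',
  [/\ inp N' = [ffun i => f (inp N i)], out N' = [ffun o => f (out N o)] &
      cells N' = rn f (cells N)].
Proof.
move=> injf; have [uN pN] := port_linear true N.
have [|N' [i o cN']] := @mk_net I O true (fun i => f (port N i)) (fun z => f (port N z))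
    (rn f (cells N)); last first.
  by exists N'; split=> //; apply/ffunP => x; rewrite ffunE; [apply: i|apply: o].
move=> w; rewrite !codom_comp !nears_rn -!cnt_cat -!map_cat.
by split; [apply: cnt_uniq; rewrite map_inj_uniq|apply/cnt_perm/perm_map].
Qed.

(** Fusing can be stated for the ports of both sides: the erased cell already holds the extremity of
    [b] that a port of side [s] would take, so by linearity [fuse] leaves those ports alone. *)
Lemma erase_id s N a b c rest :
  a != b -> perm_eq (cells N) (nd s a b c :: lf s c :: rest) ->
  exists N', [/\ net_equiv N N',
    forall t (x : side I O t), port N' x = fuse a b (port N x) &
    cells N' = rn (fuse a b) rest].
Proof.
move=> ab pN.
have cntN w : (b == w) + cnt w (codom (port N (s:=s))) + cnt w (nears (~~ s) rest) +
    (c == w) <= 1 /\ (b == w) + cnt w (codom (port N (s:=s))) + cnt w (nears (~~ s) rest)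
    = (a == w) + cnt w (codom (port N (s:=~~ s))) + cnt w (nears s rest).
  have := port_count s N w; rewrite !(count_nears _ pN) !nears_cons !cellE eqxx.
  by case: (s); rewrite /= !cnt_cons; lia.
have [|N' [ps pt cN']] := @mk_net I O s (fun x => fuse a b (port N x))
    (fun x => fuse a b (port N x)) (rn (fuse a b) rest).
  move=> w; rewrite !codom_comp !nears_rn !cnt_fuse //.
  by have := cntN w; have := cntN a; have := cntN b; rewrite !eqxx (eq_sym a w) (eq_sym b w);
    rewrite (negPf ab) (eq_sym b) (negPf ab); case: (w =P b); case: (w =P a) => [->|]; lia.
have portN' t (x : side I O t) : port N' x = fuse a b (port N x).
  by case: t x; case: s ps pt {cntN pN} => ps pt x; rewrite ?ps ?pt.
exists N'; split=> //; have not_b (x : side I O s) : port N x != b.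
  apply/eqP => xb; have := cntN b; rewrite eqxx.
  have : b \in codom (port N (s:=s)) by rewrite -xb codom_f.
  by rewrite -cnt_gt0; lia.
have not_a (x : side I O (~~ s)) : port N x != a.
  apply/eqP => xa; have := cntN a; rewrite eqxx.
  have : a \in codom (port N (s:=~~ s)) by rewrite -xa codom_f.
  by rewrite -cnt_gt0; lia.
case: s pN cntN ps pt not_b not_a => pN cntN ps pt not_b not_a.
  apply: rst_step; constructor 3; exists [:: Contr a b c; Weak c], rest, a, b.
  split; split=> //; first exact: contr_neutral.
  - apply/ffunP => x; rewrite -[inp N' x]/(port N' (x : side I O true)) portN' /fuse.
    by rewrite (negPf (not_b x)).
  - by apply/ffunP => x; rewrite ffunE -[out N' x]/(port N' (x : side I O false)) portN'.
  - by rewrite cN'.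
(* On the output side [neutrality] keeps the name [b] instead of [a]. *)
have sf w : swap a b (fuse a b w) = fuse b a w.
  rewrite /swap /fuse; case: (w =P b) => [->|/eqP wb].
    by rewrite eqxx eq_sym (negPf ab).
  by case: (w =P a) => // _; rewrite (negPf wb).
have [N1 [i1 o1 c1]] := rename_net N' (can_inj (swapK a b)).
apply: (@equiv_trans _ _ N1).
  apply: rst_step; constructor 3; exists [:: Cocontr b c a; Coweak c], rest, b, a.
  split; split=> //; first exact: cocontr_neutral.
  - by rewrite eq_sym.
  - apply/ffunP => x; rewrite i1 ffunE -[inp N' x]/(port N' (x : side I O true)) portN' sf.
    by rewrite /fuse (negPf (not_a x)).
  - apply/ffunP => x; rewrite o1 !ffunE -[out N' x]/(port N' (x : side I O false)) portN'.
    by rewrite sf.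
  - by rewrite c1 cN' rn_comp (rn_eq (g := fuse b a)) // => w t _; apply: sf.
apply: rst_sym; apply: rst_step; constructor 1; exists (swap a b).
by split; [apply: can_inj (swapK a b)|rewrite c1].
Qed.

(** Neutrality read backwards: the padded net is built directly, and erasing its identity gives [N]
    again. [g] swaps the wire of [x] with a fresh one, so that the port keeps its name and the old
    cells see the new wire. *)
Lemma insert_id s N (x : side I O s) :
  exists N' b c g, [/\ injective g, net_equiv N N',
    forall y, y != x -> port N' y = g (port N y),
    forall z : side I O (~~ s), port N' z = g (port N z) &
    cells N' = nd s (port N' x) b c :: lf s c :: rn g (cells N)].
Proof.
have [u fu] := fresh_wires N; pose a := port N x; pose b := u; pose c := u.+1.
have [fb bport] := fu b (leqnn _); have [fc cport] := fu c (leqnSn _).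
have bz t : cnt b (nears t (cells N)) = 0 by apply/eqP; rewrite cnt_eq0.
have cz t : cnt c (nears t (cells N)) = 0 by apply/eqP; rewrite cnt_eq0.
have bpz t : cnt b (codom (port N (s:=t))) = 0.
  by apply/eqP; rewrite cnt_eq0; apply/negP => /codomP[y by_]; have := bport t y; rewrite by_ eqxx.
have cpz t : cnt c (codom (port N (s:=t))) = 0.
  by apply/eqP; rewrite cnt_eq0; apply/negP => /codomP[y cy]; have := cport t y; rewrite cy eqxx.
have bc : b != c by rewrite /b /c; lia.
have ab : a != b by rewrite eq_sym; apply: bport.
have ac : a != c by rewrite eq_sym; apply: cport.
have aP : 0 < cnt a (codom (port N (s:=s))) by rewrite cnt_gt0 codom_f.
pose g := swap a b.
have [|N' [ps pt cN']] := @mk_net I O s (port N (s:=s)) (fun z => g (port N z))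
    (nd s a b c :: lf s c :: rn g (cells N)).
  have ga : g a = b by rewrite /g /swap eqxx.
  have gb : g b = a by rewrite -ga /g swapK.
  move=> w; rewrite codom_comp !nears_cons !nears_rn !cnt_cat !cnt_swap !cellE eqxx -/g.
  have eq_s : (~~ s == s) = false by case: (s).
  rewrite eq_s !cnt_cons; have := port_count s N a; have := port_count s N w.
  case: (w =P a) => [->|/eqP wa].
    rewrite ga !bz !bpz eqxx (eq_sym b) (negPf ab) (eq_sym c) (negPf ac) /cnt /=.
    rewrite -!/(cnt _ _); lia.
  case: (w =P b) => [->|/eqP wb].
    rewrite gb !bpz eqxx (negPf ab) (eq_sym c) (negPf bc) /cnt /=.
    rewrite -!/(cnt _ _); lia.
  have -> : g w = w by rewrite /g /swap (negPf wa) (negPf wb).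
  rewrite (eq_sym b) (negPf wb) (eq_sym a) (negPf wa).
  case: (c =P w) => [<-|_]; rewrite ?cz ?cpz /cnt /= -!/(cnt _ _); lia.
have g_out w : w != a -> w != b -> g w = w.
  by move=> wa wb; rewrite /g /swap (negPf wa) (negPf wb).
have inj_port y : y != x -> port N y != a.
  move=> yx; apply: contra_neq yx; apply: (injectiveP (port N (s:=s))).
  by have [] := port_linear s N; rewrite cat_uniq => /andP[].
exists N', b, c, g; rewrite ps; split=> //.
- exact: can_inj (swapK a b).
- have pN' : perm_eq (cells N') (nd s a b c :: lf s c :: rn g (cells N)) by rewrite cN'.
  have [N1 [e1 p1 c1]] := erase_id ab pN'.
  have fg w : w != b -> fuse a b (g w) = w.
    move=> wb; rewrite /fuse /g /swap; case: (w =P a) => [->|_]; first by rewrite eqxx.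
    by rewrite (negPf wb) (negPf wb).
  apply: equiv_trans (equiv_sym e1).
  have [i o] : inp N1 = inp N /\ out N1 = out N.
    apply: port_ext => t y; rewrite p1.
    have /orP[/eqP ts|/eqP ts] : (t == s) || (t == ~~ s) by case: (t); case: (s).
      by subst t; rewrite ps /fuse ifN // eq_sym.
    by subst t; rewrite pt fg // eq_sym.
  apply: perm_cells_equiv => //; rewrite c1 rn_comp (rn_eq (g := id)) ?rn_id // => w t wN.
  by apply: fg; apply: contraNneq (fb t) => <-.
- by move=> y yx; rewrite ps g_out ?inj_port // eq_sym.
Qed.

End Identities.

(** * Combs *)

(* Unlike the trees of a routing area, a comb ends with a (co)weakening even if
   it has leaves, so that the wires of its leaves differ from its root. *)
Inductive comb (s : bool) : wire -> seq wire -> seq cell -> Prop :=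
| comb_nil a : comb s a [::] [:: lf s a]
| comb_cons a x k l T : comb s k l T -> comb s a (x :: l) (nd s a x k :: T).

Lemma comb_rn s f a l T : comb s a l T -> comb s (f a) (map f l) (rn f T).
Proof.
elim=> {a l T} [a|a x k l T _ IH] /=.
  by rewrite rename_lf; constructor.
by rewrite rename_nd; constructor.
Qed.

(** [ks] is the spine: its wires start and end inside the comb, so they cancel in the counts that
    express linearity. *)
Lemma comb_nears s a l T : comb s a l T ->
  exists ks, perm_eq (nears s T) (a :: ks) /\ perm_eq (nears (~~ s) T) (l ++ ks).
Proof.
have eq_s : (~~ s == s) = false by case: (s).
elim=> {a l T} [a|a x k l T _ [ks [IHn IHf]]].
  by exists [::]; rewrite !nears_cons !cellE eqxx eq_s.
exists (k :: ks); rewrite !nears_cons !cellE eqxx eq_s; split.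
  by rewrite /= perm_cons.
by rewrite /= perm_cons perm_sym -(cat1s k ks) perm_catCA /= perm_cons perm_sym.
Qed.

Section Combs.
Variables (I O : finType).
Implicit Types (N : net I O) (s : bool) (C : seq cell).

(** Associativity brings [x] and [y] under a common node, commutativity exchanges them there, and
    associativity restores the comb. *)
Lemma comb_swap s a x y l T N rest : comb s a (x :: y :: l) T ->
  perm_eq (cells N) (T ++ rest) ->
  exists T', comb s a (y :: x :: l) T' /\ turns N (T' ++ rest).
Proof.
move=> cT pN; inversion cT as [|? ? k ? T1 cT1]; subst.
inversion cT1 as [|? ? m ? T2 cT2]; subst.
have [u t1] := turns_assoc_r pN.
have t2 : turns N (nd s u y x :: nd s a u m :: T2 ++ rest).
  have [N1 [e1 i1 o1 p1]] := t1; apply: turns_from e1 i1 o1 _.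
  by apply: turns_comm; apply: perm_trans p1 _; perm_lia.
have t3 : exists n, turns N (nd s a y n :: nd s n x m :: T2 ++ rest).
  case: t2 => N2 [e2 i2 o2 p2].
  have [|n t3] := @turns_assoc_l I O s N2 a y x m u (T2 ++ rest).
    by apply: perm_trans p2 _; perm_lia.
  by exists n; apply: turns_from t3.
have [n t4] := t3; exists (nd s a y n :: nd s n x m :: T2).
by split=> //; do 2!constructor.
Qed.

Lemma comb_front s a x l1 l2 T N rest : comb s a (l1 ++ x :: l2) T ->
  perm_eq (cells N) (T ++ rest) ->
  exists T', comb s a (x :: l1 ++ l2) T' /\ turns N (T' ++ rest).
Proof.
elim: l1 a T N rest => [|y l1 IH] a T N rest cT pN.
  by exists T; split=> //; apply: turns_refl.
inversion cT as [|? ? k ? T1 cT1]; subst.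
have [|T2 [cT2 [N2 [e2 i2 o2 p2]]]] := IH _ _ N (nd s a y k :: rest) cT1.
  by apply: perm_trans pN _; perm_lia.
have [||T3 [cT3 t3]] := @comb_swap s a y x (l1 ++ l2) (nd s a y k :: T2) N2 rest.
- by constructor.
- by apply: perm_trans p2 _; perm_lia.
by exists T3; split=> //; apply: turns_from t3.
Qed.

Lemma comb_perm s a l l' T N rest : comb s a l T -> perm_eq l l' ->
  perm_eq (cells N) (T ++ rest) ->
  exists T', comb s a l' T' /\ turns N (T' ++ rest).
Proof.
elim: l' a l T N rest => [|x l' IH] a l T N rest cT pl pN.
  by move/perm_nilP: pl cT => -> cT; exists T; split=> //; apply: turns_refl.
have /path.splitPr xl : x \in l by rewrite (perm_mem pl) mem_head.
case: l / xl cT pl => l1 l2 cT pl.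
have [T1 [cT1 [N1 [e1 i1 o1 p1]]]] := comb_front cT pN.
inversion cT1 as [|? ? k ? T2 cT2]; subst.
have [||T3 [cT3 t3]] := IH k (l1 ++ l2) T2 N1 (nd s a x k :: rest) cT2.
- by move: pl; rewrite -(cat1s x l2) perm_catCA /= perm_cons.
- by apply: perm_trans p1 _; perm_lia.
exists (nd s a x k :: T3); split; first by constructor.
apply: turns_from e1 i1 o1 _; apply: turns_perm t3 _; perm_lia.
Qed.

(** Associativity rotates the node that hangs from the leaf [b] into the spine, so that [x] and [y]
    become leaves in place of [b]. *)
Lemma absorb_nd s a l T N b x y rest : comb s a l T -> b \in l ->
  perm_eq (cells N) (T ++ nd s b x y :: rest) ->
  exists l' T', comb s a l' T' /\ turns N (T' ++ rest).
Proof.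
move=> cT; elim: cT N rest => {a l T} [//|a z k l T cT IH] N rest.
rewrite inE => /orP[/eqP bz|bl] pN.
  subst z; have [|n t1] := @turns_assoc_l I O s N a x y k b (T ++ rest).
    by apply: perm_trans pN _; perm_lia.
  by exists [:: x, y & l], [:: nd s a x n, nd s n y k & T]; split=> //; do 2!constructor.
have [|l' [T' [cT' t']]] := IH N (nd s a z k :: rest) bl.
  by apply: perm_trans pN _; perm_lia.
exists (z :: l'), (nd s a z k :: T'); split; first by constructor.
by apply: turns_perm t' _; perm_lia.
Qed.

(** After one commutation, the node that bears [b] is an identity between [a] and the rest [k] of
    the spine. Erasing it renames [k] to [a], which touches nothing else because [k] is internal to
    the comb. *)
Lemma absorb_lf s a l T N b rest : comb s a l T -> b \in l ->
  perm_eq (cells N) (T ++ lf s b :: rest) ->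
  exists l' T', comb s a l' T' /\ turns N (T' ++ rest).
Proof.
move=> cT; elim: cT N rest => {a l T} [//|a z k l T cT IH] N rest.
rewrite inE => /orP[/eqP bz|bl] pN; last first.
  have [|l' [T' [cT' t']]] := IH N (nd s a z k :: rest) bl.
    by apply: perm_trans pN _; perm_lia.
  exists (z :: l'), (nd s a z k :: T'); split; first by constructor.
  by apply: turns_perm t' _; perm_lia.
subst z; have [N1 [e1 i1 o1 p1]] : turns N (nd s a k b :: T ++ lf s b :: rest).
  exact: turns_comm.
have {}p1 : perm_eq (cells N1) (nd s a k b :: lf s b :: (T ++ rest)).
  by apply: perm_trans p1 _; perm_lia.
have eq_s : (~~ s == s) = false by case: (s).
have [ks [pn pf]] := comb_nears cT.
have := port_count s N1 k; rewrite !(count_nears _ p1) !nears_cons !nears_cat !cellE eqxx eq_s.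
rewrite !cnt_cat (cnt_perm pn) (cnt_perm pf) !cnt_cat !cnt_cons eqxx => -[le1 eq1].
have k_port t (y : side I O t) : port N1 y != k.
  apply/eqP => yk; have : 0 < cnt k (codom (port N1 (s:=t))).
    by rewrite cnt_gt0 -yk codom_f.
  have /orP[/eqP ts|/eqP ts] : (t == s) || (t == ~~ s) by case: (t); case: (s).
    by subst t; lia.
  by subst t; lia.
have k_rest t : k \notin nears t rest.
  by rewrite -cnt_eq0; case: (t) (s) le1 eq1 => [] [] /=; lia.
have k_l : k \notin l by rewrite -cnt_eq0; lia.
have ak : a != k by apply/eqP => ak; move: eq1; rewrite ak eqxx; lia.
have [N2 [e2 p2 c2]] := erase_id ak p1.
have fk w : w != k -> fuse a k w = w by rewrite /fuse => /negPf ->.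
exists l, (rn (fuse a k) T); split.
  have := comb_rn (fuse a k) cT; have -> : fuse a k k = a by rewrite /fuse eqxx.
  suff -> : map (fuse a k) l = l by [].
  by rewrite -[RHS]map_id; apply/eq_in_map => w wl; apply: fk; apply: contraNneq k_l => <-.
apply: turns_from e1 i1 o1 _; exists N2.
have [i2 o2] : inp N2 = inp N1 /\ out N2 = out N1.
  by apply: port_ext => t y; rewrite p2 fk // k_port.
split=> //; rewrite c2 rn_cat perm_cat2l (rn_eq (g := id)) ?rn_id // => w t wr.
by apply: fk; apply: contraNneq (k_rest t) => <-.
Qed.

End Combs.

(** * Concatenation over a finite type *)

Definition gather (X : finType) (A : Type) (T : X -> seq A) : seq A :=
  flatten [seq T x | x <- enum X].

Lemma nears_gather (X : finType) (T : X -> seq cell) s :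
  nears s (gather T) = gather (fun x => nears s (T x)).
Proof.
by rewrite /gather; elim: (enum X) => //= x xs IH; rewrite nears_cat IH.
Qed.

Lemma rn_gather (X : finType) (T : X -> seq cell) f :
  rn f (gather T) = gather (fun x => rn f (T x)).
Proof. by rewrite /gather; elim: (enum X) => //= x xs IH; rewrite rn_cat IH. Qed.

Lemma mem_gather (X : finType) (A : eqType) (T : X -> seq A) a :
  reflect (exists x, a \in T x) (a \in gather T).
Proof.
apply: (iffP flatten_mapP) => [[x _ ax]|[x ax]]; first by exists x.
by exists x => //; rewrite mem_enum.
Qed.

Lemma perm_gather_cat (X : finType) (A : eqType) (T T1 T2 : X -> seq A) :
  (forall x, perm_eq (T x) (T1 x ++ T2 x)) ->
  perm_eq (gather T) (gather T1 ++ gather T2).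
Proof.
move=> TT; rewrite /gather; elim: (enum X) => //= x xs IH.
apply/permP => p; move/permP/(_ p): IH; move/permP/(_ p): (TT x).
by rewrite !count_cat; lia.
Qed.

Lemma perm_gather (X : finType) (A : eqType) (T T' : X -> seq A) :
  (forall x, perm_eq (T x) (T' x)) -> perm_eq (gather T) (gather T').
Proof.
move=> TT; have := @perm_gather_cat X A T T' (fun=> [::]).
have -> : gather (fun _ : X => [::]) = [::] :> seq A.
  by rewrite /gather; elim: (enum X).
by rewrite cats0; apply=> x; rewrite cats0.
Qed.

(** The remainder [C] is the same before and after the update, which allows work on one comb at a
    time. *)
Lemma gather_update (X : finType) (T : X -> seq cell) x :
  exists C, perm_eq (gather T) (T x ++ C) /\
    forall t, perm_eq (gather (fun y => if y == x then t else T y)) (t ++ C).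
Proof.
have pX : perm_eq (enum X) (x :: rem x (enum X)) by rewrite perm_to_rem ?mem_enum.
exists (flatten [seq T y | y <- rem x (enum X)]); split=> [|t].
  exact: (perm_flatten (perm_map T pX)).
apply: perm_trans (perm_flatten (perm_map _ pX)) _; rewrite /= eqxx perm_cat2l.
have -> // : [seq if y == x then t else T y | y <- rem x (enum X)] = map T (rem x (enum X)).
apply/eq_in_map => y; rewrite mem_rem_uniq ?enum_uniq // inE => /andP[/negPf ->] //.
Qed.

(** * Absorption of all cells into combs *)

Section Assembly.
Variables (I O : finType).
Implicit Types (N : net I O) (s : bool) (C : seq cell).

Definition combed s N (L : side I O s -> seq wire) (T : side I O s -> seq cell) : Prop :=
  forall x, comb s (port N x) (L x) (T x).

(** Every port of side [s] becomes the root of a comb, even when it ends a floating wire; the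
    absorption starts from these combs. *)
Lemma pad_side s N : exists N' g L T, [/\ injective g, net_equiv N N',
  combed (s:=s) N' L T, forall z : side I O (~~ s), port N' z = g (port N z) &
  perm_eq (cells N') (gather T ++ rn g (cells N))].
Proof.
suff pad (xs : seq (side I O s)) : uniq xs -> exists N' g L T,
    [/\ injective g, net_equiv N N',
      forall x, if x \in xs then comb s (port N' x) (L x) (T x)
                else port N' x = g (port N x),
      forall z : side I O (~~ s), port N' z = g (port N z) &
      perm_eq (cells N') (flatten [seq T x | x <- xs] ++ rn g (cells N))].
  have [N' [g [L [T [h1 h2 h3 h4 h5]]]]] := pad _ (enum_uniq (side I O s)).
  by exists N', g, L, T; split=> // x; have := h3 x; rewrite mem_enum.
elim: xs => [|x xs IH] /= => [_|/andP[xxs /IH]].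
  exists N, id, (fun=> [::]), (fun=> [::]); split=> //; first exact: equiv_refl.
  by rewrite /= rn_id.
move=> [N1 [g1 [L1 [T1 [h1 h2 h3 h4 h5]]]]].
have [N2 [b [c [g [k1 k2 k3 k4 k5]]]]] := insert_id N1 x.
exists N2, (g \o g1), (fun y => if y == x then [:: b] else map g (L1 y)),
  (fun y => if y == x then [:: nd s (port N2 x) b c; lf s c] else rn g (T1 y)); split.
- exact: inj_comp.
- exact: equiv_trans k2.
- move=> y; rewrite inE; case: (y =P x) => [->|/eqP yx] /=.
    by do 2!constructor.
  by have := h3 y; rewrite k3 //; case: ifP => [_ /(comb_rn g)|_ ->].
- by move=> z; rewrite k4 h4.
rewrite k5 eqxx -rn_comp.
have -> : [seq if y == x then [:: nd s (port N2 x) b c; lf s c] else rn g (T1 y) | y <- xs]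
    = [seq rn g (T1 y) | y <- xs].
  by apply/eq_in_map => y yxs; rewrite ifN //; apply: contraNneq xxs => <-.
rewrite /= !perm_cons; apply: perm_trans (perm_map (rename g) h5) _.
rewrite map_cat; apply: perm_cat; last exact: perm_refl.
by rewrite map_flatten -map_comp.
Qed.

Lemma comb_reorder s N L L' T rest :
  combed (s:=s) N L T -> (forall x, perm_eq (L x) (L' x)) ->
  perm_eq (cells N) (gather T ++ rest) ->
  exists T', combed (s:=s) N L' T' /\ turns N (gather T' ++ rest).
Proof.
move=> cT LL pN; suff reorder (xs : seq (side I O s)) : exists T',
    combed N (fun x => if x \in xs then L' x else L x) T' /\ turns N (gather T' ++ rest).
  have [T' [cT' t']] := reorder (enum (side I O s)); exists T'; split=> // x.
  by have := cT' x; rewrite mem_enum.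
elim: xs => [|x xs [T1 [cT1 [N1 [e1 i1 o1 p1]]]]].
  by exists T; split=> //; apply: turns_refl.
have port1 t (y : side I O t) : port N1 y = port N y by case: t y => y; rewrite /port ?i1 ?o1.
have [C [pC updC]] := gather_update T1 x.
have := cT1 x; rewrite -port1 => cT1x.
have [||t [ct tt]] := comb_perm (l' := L' x) (N := N1) (rest := C ++ rest) cT1x.
- by case: ifP.
- by apply: perm_trans p1 _; rewrite catA perm_cat2r.
exists (fun y => if y == x then t else T1 y); split=> [y|].
  rewrite inE; case: (y =P x) => [->|_] /=; first by rewrite -port1.
  exact: cT1.
apply: turns_from e1 i1 o1 _; apply: turns_perm tt _.
by rewrite catA perm_cat2r perm_sym.
Qed.

Lemma side_rank s N vin r : labelled 0 vin r N -> exists rho : wire -> nat,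
  forall c w, c \in cells N -> kind c = s -> w \in near (~~ s) c -> rho (principal c) < rho w.
Proof.
move=> [phi [rho [_ _ lc]]]; case: s.
  exists rho => c w /lc; case: c => [a|a|a b c|a b c] //= [_ _ h1 h2] _.
  by rewrite !inE => /orP[] /eqP ->.
(* On the output side the rank is reversed. The sum bounds the rank of every principal wire, so that
   truncated subtraction keeps the inequalities strict. *)
exists (fun w => sumn [seq rho (principal c) | c <- cells N] - rho w).
move=> c w cN; have : rho (principal c) <= sumn [seq rho (principal c) | c <- cells N].
  rewrite (perm_sumn (perm_map (fun c => rho (principal c)) (perm_to_rem cN))) /=.
  exact: leq_addr.
case: c cN => [a|a|a b c|a b c] /lc //= [_ h1 h2] le_c _.
by rewrite !inE => /orP[] /eqP ->; lia.
Qed.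

Lemma absorb_cell s a l T N c rest : comb s a l T -> kind c = s -> principal c \in l ->
  perm_eq (cells N) (T ++ c :: rest) ->
  exists l' T', comb s a l' T' /\ turns N (T' ++ rest).
Proof.
move=> cT; case: c / cellP => [t a' b d|t a']; rewrite !cellE => -> al pN.
  exact: absorb_nd cT al pN.
exact: absorb_lf cT al pN.
Qed.

(** [F] stands for the combs of the other side, which stay fixed. The other extremity of the
    principal wire of a cell of kind [s] in [rest] cannot be at a port, on a spine or in [F], by
    linearity, nor at a cell of the other kind, by the last hypothesis. It is a leaf of a comb, or
    else it leads to a cell of kind [s] of smaller rank; so some cell hangs from a leaf and can be
    absorbed. *)
Lemma absorb_side s N vin r L T F rest :
  labelled 0 vin r N -> combed (s:=s) N L T ->
  perm_eq (cells N) (gather T ++ F ++ rest) ->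
  (forall w, w \in nears (~~ s) F ->
     w \in nears s F \/ exists z : side I O (~~ s), w = port N z) ->
  (forall c c', c \in rest -> c' \in rest -> kind c = s -> kind c' = ~~ s ->
     principal c != principal c') ->
  exists L' T', combed (s:=s) N L' T' /\
    turns N (gather T' ++ F ++ [seq c <- rest | kind c != s]).
Proof.
have [n] := ubnP (count (fun c => kind c == s) rest).
elim: n N L T rest => // n IH N L T rest lt_n lab cT pN Fc face.
case: (boolP (has (fun c => kind c == s) rest)) => [/hasP[c0 c0r /eqP kc0]|hasN]; last first.
  exists L, T; split=> //; have -> : [seq c <- rest | kind c != s] = rest.
    by apply/all_filterP; rewrite all_predC.
  exact: turns_refl.
have cntN w : cnt w (codom (port N (s:=s))) + (cnt w (gather (fun x => nears (~~ s) (T x))) +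
      (cnt w (nears (~~ s) F) + cnt w (nears (~~ s) rest))) <= 1 /\
    cnt w (codom (port N (s:=s))) + (cnt w (gather (fun x => nears (~~ s) (T x))) +
      (cnt w (nears (~~ s) F) + cnt w (nears (~~ s) rest)))
    = cnt w (codom (port N (s:=~~ s))) + (cnt w (gather (fun x => nears s (T x))) +
      (cnt w (nears s F) + cnt w (nears s rest))).
  have := port_count s N w.
  by rewrite !(count_nears _ pN) !nears_cat !cnt_cat !nears_gather.
have [rho rhoP] := side_rank s lab.
have [c [x [cr kc cx]]] : exists c x, [/\ c \in rest, kind c = s & principal c \in L x].
  have [m] := ubnP (rho (principal c0)); elim: m c0 c0r kc0 => // m IHm c cr kc lt_m.
  have [b eb] : exists b, principal c = b by exists (principal c).
  rewrite eb ltnS in lt_m.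
  have br : 0 < cnt b (nears s rest).
    by rewrite cnt_gt0; apply: mem_nears cr _; rewrite -kc near_kind inE eb.
  have := cntN b => -[le1 eq1].
  have : (b \in codom (port N (s:=s))) || (b \in gather (fun x => nears (~~ s) (T x)))
      || (b \in nears (~~ s) F) || (b \in nears (~~ s) rest).
    by rewrite -!mem_cat -cnt_gt0 !cnt_cat; clear -br eq1; lia.
  case/orP => [/orP[/orP[/codomP[x bx]|/mem_gather[x bT]]|/Fc[bF|[z bz]]]|/nearsP[c' c'r bc']].
  - have [ks [pn _]] := comb_nears (cT x).
    suff : 0 < cnt b (gather (fun x => nears s (T x))) by clear -br le1 eq1; lia.
    rewrite cnt_gt0; apply/mem_gather; exists x.
    by rewrite (perm_mem pn) -bx mem_head.
  - have [ks [pn pf]] := comb_nears (cT x).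
    move: bT; rewrite (perm_mem pf) mem_cat => /orP[bl|bk]; first by exists c, x; rewrite eb.
    suff : 0 < cnt b (gather (fun x => nears s (T x))) by clear -br le1 eq1; lia.
    rewrite cnt_gt0; apply/mem_gather; exists x.
    by rewrite (perm_mem pn) inE bk orbT.
  - by move: bF; rewrite -cnt_gt0; clear -br le1 eq1; lia.
  - suff : 0 < cnt b (codom (port N (s:=~~ s))) by clear -br le1 eq1; lia.
    by rewrite cnt_gt0 bz codom_f.
  - case: (eqVneq (kind c') s) => [kc'|kc'].
      (* The wire is an auxiliary wire of [c'], whose principal wire has a smaller rank: the search
         goes on from [c']. *)
      apply: (IHm c') => //; apply: leq_trans lt_m.
      apply: rhoP bc' => //; by rewrite (perm_mem pN) !mem_cat c'r !orbT.
    have {}kc' : kind c' = ~~ s by case: (kind c') (s) kc' => [] [].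
    have := face c c' cr c'r kc kc'.
    by move: bc'; rewrite -kc' near_kind inE eb => ->.
have [C [pC updC]] := gather_update T x.
have pr := perm_to_rem cr.
have [|l' [t [ct [N1 [e1 i1 o1 p1]]]]] :=
    absorb_cell (N := N) (rest := C ++ F ++ rem c rest) (cT x) kc cx.
  apply: perm_trans pN _; apply/permP => p.
  move/permP/(_ p): pC; move/permP/(_ p): pr; rewrite !count_cat /= !count_cat /=; clear; lia.
have port1 u (y : side I O u) : port N1 y = port N y by case: u y => y; rewrite /port ?i1 ?o1.
have [||||||L' [T' [cT' t']]] := IH N1 (fun y => if y == x then l' else L y)
    (fun y => if y == x then t else T y) (rem c rest).
- by move/permP/(_ (fun c => kind c == s)): pr lt_n => -> /=; rewrite kc eqxx; clear; lia.
- exact: (labelled_equiv vin r e1).1.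
- by move=> y; rewrite port1; case: eqP => [->|_]; last exact: cT.
- apply: perm_trans p1 _; apply/permP => p.
  by move/permP/(_ p): (updC t); rewrite !count_cat; clear; lia.
- by move=> w /Fc[|[z ->]]; [left|right; exists z; rewrite port1].
- by move=> c1 c2 /mem_rem h1 /mem_rem h2; apply: face.
exists L', T'; split; first by move=> y; rewrite -port1.
apply: turns_from e1 i1 o1 _; apply: turns_perm t' _.
rewrite !perm_cat2l perm_sym; apply: perm_trans (perm_filter _ pr) _.
by rewrite /= kc eqxx.
Qed.

End Assembly.

(** * Canonical nets *)

Lemma cnt_gather_filter (X : finType) (M : X -> seq wire) l w :
  uniq (gather M) ->
  cnt w (gather (fun x => [seq v <- l | v \in M x])) = cnt w l * cnt w (gather M).
Proof.
rewrite /gather; elim: (enum X) => [|x xs IH] /=; first by rewrite /cnt /= muln0.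
rewrite cat_uniq => /and3P[uM _ /IH{}IH]; rewrite !cnt_cat IH mulnDr; congr (_ + _).
rewrite {1}/cnt count_filter; have -> : cnt w (M x) = (w \in M x) by rewrite /cnt count_uniq_mem.
case: (boolP (w \in M x)) => wM; rewrite ?muln1 ?muln0.
  by apply: eq_count => v /=; case: eqP => [->|].
rewrite -[RHS](@count_pred0 _ l); apply: eq_count => v /=.
by case: eqP => // ->; rewrite (negPf wM).
Qed.

(** As no wire occurs twice in [gather M], the lists [M x] are disjoint and cut [l] into blocks. *)
Lemma perm_gather_filter (X : finType) (M : X -> seq wire) l :
  uniq (gather M) -> {subset l <= gather M} ->
  perm_eq l (gather (fun x => [seq v <- l | v \in M x])).
Proof.
move=> uM lM; apply: perm_cnt => w; rewrite cnt_gather_filter //.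
have [wl|] := boolP (w \in l); last by rewrite -cnt_eq0 => /eqP ->.
by rewrite [X in _ * X]/cnt count_uniq_mem // lM // muln1.
Qed.

Lemma uniq_gather (X : finType) (M : X -> seq wire) x : uniq (gather M) -> uniq (M x).
Proof.
rewrite /gather (perm_uniq (perm_flatten (perm_map M (perm_to_rem (mem_enum X x))))).
by rewrite /= cat_uniq => /andP[].
Qed.

Lemma comb_true_labels phi rho a l T : comb true a l T ->
  (forall c, c \in T -> constraint 0 phi rho c) -> forall x, x \in l -> phi x = phi a.
Proof.
elim=> {a l T} [//|a x k l T _ IH] h y.
have [ex ek _ _] := h (Contr a x k) (mem_head _ _).
rewrite inE => /orP[/eqP -> //|/IH -> //] c cT; apply: h.
by rewrite inE cT orbT.
Qed.

Lemma comb_false_labels phi rho a l T : comb false a l T ->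
  (forall c, c \in T -> constraint 0 phi rho c) -> phi a = sumn (map phi l).
Proof.
elim=> {a l T} [a|a x k l T _ IH] h /=; first exact: (h (Coweak a) (mem_head _ _)).
have [-> _ _] := h (Cocontr x k a) (mem_head _ _).
by rewrite IH ?addn0 // => c cT; apply: h; rewrite inE cT orbT.
Qed.

(** Meant for the valuation of the paths from a single input: its sum over a column counts the links
    that come from that input. *)
Lemma sumn_gather_delta (X : finType) (F : X -> seq wire) (phi : wire -> nat) x :
  (forall y w, w \in F y -> phi w = (x == y)) ->
  sumn (map phi (gather F)) = size (F x).
Proof.
move=> h; suff sum (xs : seq X) : uniq xs ->
    sumn (map phi (flatten (map F xs))) = if x \in xs then size (F x) else 0.
  by rewrite sum ?enum_uniq // mem_enum.
elim: xs => //= y xs IH /andP[yxs /IH{}IH]; rewrite map_cat sumn_cat {}IH inE.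
have -> : map phi (F y) = nseq (size (F y)) (x == y : nat).
  have -> : map phi (F y) = [seq (x == y : nat) | _ <- F y].
    by apply/eq_in_map => w /h.
  by elim: (F y) => //= _ s ->.
rewrite sumn_nseq; case: (eqVneq x y) => [->|_] /=; last by rewrite mul0n.
by rewrite (negPf yxs) mul1n addn0.
Qed.

Section Canonical.
Variables (I O : finType).
Implicit Types (N : net I O) (s : bool) (C : seq cell) (R : multirelation I O).

Definition row (link : I * O -> seq wire) (i : I) : seq wire := gather (fun o => link (i, o)).
Definition col (link : I * O -> seq wire) (o : O) : seq wire := gather (fun i => link (i, o)).

(** A routing area with combs instead of trees. [row] and [col] traverse the same lists [link x] in
    the same internal order, which makes the net rigid once their sizes are known. *)
Definition canonical R N (link : I * O -> seq wire)
    (T : I -> seq cell) (U : O -> seq cell) : Prop :=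
  [/\ forall x, size (link x) = R x,
      forall i, comb true (inp N i) (row link i) (T i),
      forall o, comb false (out N o) (col link o) (U o) &
      perm_eq (cells N) (gather T ++ gather U)].

(** Giving weight 1 to a single input extracts one row of the matrix. The first clause still
    provides a rank when [I] is empty and the second one is vacuous. *)
Definition counts R N : Prop :=
  (exists r, labelled 0 (fun=> 0) r N) /\
  forall i, labelled 0 (fun j => i == j : nat) (fun o => R (i, o)) N.

Lemma counts_reduces R N N' : reduces N N' -> counts R N -> counts R N'.
Proof.
move=> NN' [[r l0] li]; split; last by move=> i; apply: labelled_reduces NN' (li i).
by exists r; apply: labelled_reduces NN' l0.
Qed.

Lemma reduces_equiv N N' : net_equiv N N' -> reduces N N'.
Proof. by move=> e; apply: rt_step; left. Qed.

(** Once the spines cancel, linearity makes the leaves of the input combs and of the output combs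
    the same wires, each occurring once. The links from [i] to [o] are the common leaves of two
    combs, and reordering the leaves groups them. *)
Lemma combs_canonical R N (L : I -> seq wire) (M : O -> seq wire) T U :
  counts R N ->
  (forall i, comb true (inp N i) (L i) (T i)) ->
  (forall o, comb false (out N o) (M o) (U o)) ->
  perm_eq (cells N) (gather T ++ gather U) ->
  exists P link T' U', net_equiv N P /\ canonical R P link T' U'.
Proof.
move=> cN cT cU pN.
have [KT KTP] := fin_all_exists (fun i => comb_nears (cT i)).
have [KU KUP] := fin_all_exists (fun o => comb_nears (cU o)).
have LM : forall w, cnt w (gather L) = cnt w (gather M) /\ cnt w (gather L) <= 1.
  move=> w; have := port_count true N w.
  rewrite !(count_nears _ pN) !nears_cat !cnt_cat !nears_gather /=.
  have T1 : cnt w (gather (fun i => nears false (T i))) = cnt w (gather L) + cnt w (gather KT).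
    rewrite -cnt_cat; apply: cnt_perm; apply: perm_gather_cat => i; exact: (KTP i).2.
  have T2 : cnt w (gather (fun i => nears true (T i)))
      = cnt w (codom (port N (s:=true))) + cnt w (gather KT).
    rewrite -cnt_cat; apply: cnt_perm; have -> : codom (port N (s:=true))
      = gather (fun i => [:: inp N i]) by rewrite codomE /gather; elim: (enum I) => //= i l ->.
    by apply: perm_gather_cat => i; exact: (KTP i).1.
  have U1 : cnt w (gather (fun o => nears true (U o))) = cnt w (gather M) + cnt w (gather KU).
    rewrite -cnt_cat; apply: cnt_perm; apply: perm_gather_cat => o; exact: (KUP o).2.
  have U2 : cnt w (gather (fun o => nears false (U o)))
      = cnt w (codom (port N (s:=false))) + cnt w (gather KU).
    rewrite -cnt_cat; apply: cnt_perm; have -> : codom (port N (s:=false))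
      = gather (fun o => [:: out N o]) by rewrite codomE /gather; elim: (enum O) => //= i l ->.
    by apply: perm_gather_cat => o; exact: (KUP o).1.
  by rewrite T1 T2 U1 U2; clear; lia.
have uL : uniq (gather L) by apply: uniq_cnt => w; case: (LM w).
have uM : uniq (gather M) by apply: uniq_cnt => w; case: (LM w) => <-.
have LMmem w : (w \in gather L) = (w \in gather M).
  by rewrite -!cnt_gt0; case: (LM w) => ->.
pose link (x : I * O) := [seq w <- L x.1 | w \in M x.2].
have pL i : perm_eq (L i) (row link i).
  apply: perm_gather_filter uM _ => w wi; rewrite -LMmem; apply/mem_gather; by exists i.
have pM o : perm_eq (M o) (col link o).
  apply: perm_trans (perm_gather_filter (l := M o) uL _) _.
    by move=> w wo; rewrite LMmem; apply/mem_gather; exists o.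
  apply: perm_gather => i; apply: uniq_perm; rewrite ?filter_uniq //.
  - exact: uniq_gather uM.
  - exact: uniq_gather uL.
  by move=> w; rewrite !mem_filter andbC.
have [|T1 [cT1 [N1 [e1 i1 o1 p1]]]] := @comb_reorder I O true N L (row link) T (gather U) cT pL.
- exact: pN.
have [||U2 [cU2 [P [e2 i2 o2 p2]]]] :=
  @comb_reorder I O false N1 M (col link) U (gather T1) _ pM.
- by move=> o; rewrite /port o1; apply: cU.
- by apply: perm_trans p1 _; rewrite perm_catC.
have cP : counts R P.
  by apply: counts_reduces cN; apply: reduces_equiv; apply: equiv_trans e2.
have pP : perm_eq (cells P) (gather T1 ++ gather U2).
  by apply: perm_trans p2 _; rewrite perm_catC.
have cT1' i : comb true (inp P i) (row link i) (T1 i).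
  by rewrite i2 i1; apply: cT1.
have cU2' o : comb false (out P o) (col link o) (U2 o).
  by rewrite o2; apply: cU2.
exists P, link, T1, U2; split; first exact: equiv_trans e2.
(* The valuation of the paths from [i] is 1 on the leaves of the comb of [i] and 0 on those of the
   other input combs; its sum at [o] is thus the number of links, while [counts] says that it is
   [R (i, o)]. *)
split=> // [[i o]]; have [_ /(_ i) [phi [rho [hi ho hc]]]] := cP.
rewrite -ho (comb_false_labels (phi := phi) (rho := rho) (cU2' o)); last first.
  move=> c cU0; apply: hc; rewrite (perm_mem pP) mem_cat; apply/orP; right.
  by apply/mem_gather; exists o.
symmetry; apply: sumn_gather_delta => j w wl; rewrite -hi.
apply: (comb_true_labels (rho := rho) (cT1' j)).
  move=> c cT0; apply: hc; rewrite (perm_mem pP) mem_cat; apply/orP; left.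
  by apply/mem_gather; exists j.
by apply/mem_gather; exists o.
Qed.

(** Both sides are padded, then contractions and weakenings are absorbed from the inputs and the
    remaining cells from the outputs. Padding renames the cells of [N] injectively, so that still no
    two of them face each other. *)
Lemma normal_canonical R N : normal N -> counts R N ->
  exists P link T U, net_equiv N P /\ canonical R P link T U.
Proof.
move=> nN cN.
have [N1 [g1 [L1 [T1 [inj1 e1 c1 q1 p1]]]]] := pad_side true N.
have [N2 [g2 [L2 [U2 [inj2 e2 c2 q2 p2]]]]] := pad_side false N1.
pose g := g2 \o g1; have injg : injective g by apply: inj_comp.
have p2' : perm_eq (cells N2)
    (gather (fun i => rn g2 (T1 i)) ++ gather U2 ++ rn g (cells N)).
  apply: perm_trans p2 _; rewrite -rn_gather.
  apply: perm_trans (perm_cat (perm_refl (gather U2)) (perm_map (rename g2) p1)) _.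
  by rewrite -/(rn g2 _) rn_cat rn_comp perm_catCA.
have c2T : combed (s:=true) N2 (fun i => map g2 (L1 i)) (fun i => rn g2 (T1 i)).
  by move=> i; rewrite (q2 i); apply: comb_rn; apply: c1.
have face c c' : c \in rn g (cells N) -> c' \in rn g (cells N) ->
    kind c -> ~~ kind c' -> principal c != principal c'.
  move=> /mapP[d dN ->] /mapP[d' d'N ->]; rewrite !kind_rename !principal_rename => kd kd'.
  by rewrite (inj_eq injg); apply: normal_facing nN dN d'N kd kd'.
have [[r lab0] _] := cN.
have e12 := equiv_trans e1 e2.
(* [T3] gives the leaves and [L3] the cells of the new input combs; the output combs [U2] are the
   fixed part here. *)
have [||T3 [L3 [cT3 [N3 [e3 i3 o3 p3]]]]] :=
    absorb_side ((labelled_equiv _ _ e12).1 lab0) c2T p2'.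
- move=> w /= /nearsP[c /mem_gather[o co] wc].
  have [ks [pn pf]] := comb_nears (c2 o).
  have := mem_nears (s := false) co wc; rewrite (perm_mem pn) inE => /orP[/eqP ->|wk].
    by right; exists o.
  left; rewrite nears_gather; apply/mem_gather; exists o.
  by rewrite (perm_mem pf) mem_cat wk orbT.
- by move=> c c' cr c'r kc kc'; apply: face; rewrite ?kc ?kc'.
have p3' : perm_eq (cells N3)
    (gather U2 ++ gather L3 ++ [seq c <- rn g (cells N) | kind c != true]).
  by apply: perm_trans p3 _; rewrite perm_catCA.
have c3U : combed (s:=false) N3 L2 U2 by move=> o; rewrite /port o3; apply: c2.
have cT3' i : comb true (inp N3 i) (T3 i) (L3 i) by rewrite i3; apply: cT3.
have e123 := equiv_trans e12 e3.
have [||M4 [U4 [cU4 [N4 [e4 i4 o4 p4]]]]] :=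
    absorb_side ((labelled_equiv _ _ e123).1 lab0) c3U p3'.
- move=> w /= /nearsP[c /mem_gather[i ci] wc].
  have [ks [pn pf]] := comb_nears (cT3' i).
  have := mem_nears (s := true) ci wc; rewrite (perm_mem pn) inE => /orP[/eqP ->|wk].
    by right; exists i.
  left; rewrite nears_gather; apply/mem_gather; exists i.
  by rewrite (perm_mem pf) mem_cat wk orbT.
- by move=> c c'; rewrite !mem_filter => /andP[_ h1] /andP[_ h2] kc kc';
    rewrite eq_sym; apply: face; rewrite ?kc ?kc'.
have p4' : perm_eq (cells N4) (gather L3 ++ gather U4).
  apply: perm_trans p4 _; rewrite -filter_predI.
  have -> : [seq c <- rn g (cells N) | predI (fun c => kind c != false)
      (fun c => kind c != true) c] = [::].
    by apply/eqP; rewrite -[_ == _]negbK -has_filter; apply/hasPn => c _ /=; case: (kind c).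
  by rewrite cats0 perm_catC.
have e1234 := equiv_trans e123 e4.
have [||||P [link [T [U [eP cP]]]]] := @combs_canonical R N4 T3 M4 L3 U4.
- by apply: counts_reduces cN; apply: reduces_equiv.
- by move=> i; rewrite i4; apply: cT3'.
- by move=> o; rewrite o4; apply: cU4.
- exact: p4'.
by exists P, link, T, U; split=> //; apply: equiv_trans eP.
Qed.


End Canonical.

(** * Rigidity of canonical nets *)

Lemma renaming_exists (S1 S2 : seq wire) : uniq S1 -> uniq S2 -> size S1 = size S2 ->
  exists f, injective f /\ map f S1 = S2.
Proof.
move=> u1 u2 sz.
have le_S2 w : w \in S2 -> w <= sumn S2.
  by elim: S2 {u2 sz} => //= a l IH; rewrite inE => /orP[/eqP ->|/IH]; lia.
(* Names outside [S1] are shifted beyond every element of [S2], so that [f] is injective on all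
   names, as [alpha] demands. *)
pose f w := if w \in S1 then nth 0 S2 (index w S1) else w + (sumn S2).+1.
have f_in w : w \in S1 -> f w \in S2.
  by move=> wS; rewrite /f wS mem_nth // -sz index_mem.
exists f; split=> [v w|].
  case: (boolP (v \in S1)) (boolP (w \in S1)) => [vS|vS] [wS|wS].
  - rewrite /f vS wS => /eqP; rewrite nth_uniq // -?sz ?index_mem // => /eqP.
    by move=> /(congr1 (nth 0 S1)); rewrite !nth_index.
  - by have := le_S2 _ (f_in v vS); rewrite {3}/f (negPf wS); lia.
  - by have := le_S2 _ (f_in w wS); rewrite {2}/f (negPf vS); lia.
  - by rewrite /f (negPf vS) (negPf wS); lia.
apply: (@eq_from_nth _ 0); rewrite size_map // => k lt_k.
by rewrite (nth_map 0) // /f mem_nth // index_uniq.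
Qed.

Lemma gather_inj (X : finType) (A : eqType) (F G : X -> seq A) :
  (forall x, size (F x) = size (G x)) -> gather F = gather G -> F =1 G.
Proof.
move=> sz FG x; have /eq_in_map-> // : map F (enum X) = map G (enum X).
  apply: eq_from_flatten_shape FG _; rewrite /shape -!map_comp.
  by apply: eq_map => y /=.
by rewrite mem_enum.
Qed.

Lemma size_gather (X : finType) (A : Type) (F : X -> seq A) :
  size (gather F) = sumn [seq size (F x) | x <- enum X].
Proof. by rewrite /gather size_flatten /shape -map_comp. Qed.

Lemma map_gather (X : finType) (A B : Type) (f : A -> B) (F : X -> seq A) :
  map f (gather F) = gather (fun x => map f (F x)).
Proof. by rewrite /gather map_flatten -map_comp. Qed.

Lemma comb_size s a l T : comb s a l T ->
  size (nears false T) = if s then (size l).*2 else (size l).+1.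
Proof.
elim=> {a l T} [a|a x k l T _]; first by case: s.
by rewrite nears_cons size_cat => ->; case: s.
Qed.

(** Each node of a contraction comb emits a leaf and the root of the next node, so the root and the
    emitted wires determine everything. *)
Lemma comb_true_map f a l T l' T' :
  comb true a l T -> comb true (f a) l' T' -> size l = size l' ->
  map f (nears false T) = nears false T' -> map f l = l' /\ T' = rn f T.
Proof.
move=> c; elim: c l' T' => {a l T} [a|a x k l T _ IH] l' T' c'.
  by inversion c'; subst.
inversion c' as [|? x' k' l1 T1 c1]; subst => // -[sz].
rewrite nears_cons map_cat /= => -[ex ek eT].
by have [|-> ->] := IH l1 T1 _ sz eT; rewrite ?ek // ex.
Qed.

(** A cocontraction comb emits its root and its spine, so here it is the leaves that must be known
    beforehand. *)
Lemma comb_false_map f a l T a' T' :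
  comb false a l T -> comb false a' (map f l) T' ->
  map f (nears false T) = nears false T' -> f a = a' /\ T' = rn f T.
Proof.
move=> c; elim: c a' T' => {a l T} [a|a x k l T _ IH] a' T' c'.
  by inversion c'; subst => -[<-].
inversion c' as [|? x' k' l1 T1 c1]; subst.
rewrite nears_cons map_cat /= => -[ea eT].
by have [<- ->] := IH _ _ c1 eT; rewrite ea.
Qed.

(** * From combs to the trees of a routing area *)

Definition tree (s : bool) : wire -> seq wire -> seq cell -> Prop :=
  if s then contr_tree else cocontr_tree.

Definition branch (s : bool) : wire -> seq wire -> seq cell -> Prop :=
  if s then contr_branch else cocontr_branch.

Definition id_cells (s : bool) (x : wire * wire * wire) : seq cell :=
  let: (a, b, c) := x in [:: nd s a b c; lf s c].

(** The last node of a nonempty comb and the final (co)weakening form an identity. The statement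
    quantifies over [f] because the identities of all combs are erased in succession, and [f] will
    be the composite of the fusions. *)
Lemma comb_branch s a x l T : comb s a (x :: l) T ->
  exists id u, perm_eq T (id_cells s id ++ u) /\
    forall f, f id.1.1 = f id.1.2 -> branch s (f a) (map f (x :: l)) (rn f u).
Proof.
elim: l a x T => [|y l IH] a x T cT; inversion cT as [|? ? k ? T1 cT1]; subst.
  inversion cT1; subst; exists (a, x, k), [::]; split=> // f /= ->.
  by case: s {cT cT1}; constructor.
have [id [u [pT1 bu]]] := IH k y T1 cT1; exists id, (nd s a x k :: u); split.
  have := pT1; rewrite -(perm_cons (nd s a x k)) => /perm_trans; apply.
  by rewrite -[_ :: u]cat1s -[_ :: _ ++ u]cat1s perm_catCA.
move=> f /bu{}bu; case: s bu {IH cT cT1 pT1} => bu /=.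
  by apply: (contr_node (f a) (contr_leaf (f x)) bu).
by apply: (cocontr_node (f a) (cocontr_leaf (f x)) bu).
Qed.

Lemma comb_tree s a l T : comb s a l T -> exists ids u,
  perm_eq T (flatten (map (id_cells s) ids) ++ u) /\
  forall f, (forall id, id \in ids -> f id.1.1 = f id.1.2) ->
    tree s (f a) (map f l) (rn f u).
Proof.
case: l => [|x l] cT.
  exists [::], T; split=> // f _; inversion cT; subst.
  by rewrite /= rename_lf; case: s {cT}; constructor.
have [id [u [pT bu]]] := comb_branch cT; exists [:: id], u.
rewrite /= cats0; split=> // f fid; have {}bu := bu f (fid id (mem_head _ _)).
by case: s bu {cT pT}; constructor.
Qed.

Lemma branch_cells s a l t c : branch s a l t -> c \in t ->
  kind c = s /\ (principal c = a \/ principal c \in nears (~~ s) t).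
Proof.
rewrite /branch; case: s => b; elim: b c => {a l t} // a b d l l' t t' _ IH _ IH' c;
  rewrite inE => /orP[/eqP ->|]; try by split=> //; left.
- rewrite mem_cat nears_cons nears_cat /= !inE !mem_cat => /orP[/IH|/IH'] [-> [->|->]];
    by split=> //; right; rewrite ?eqxx ?orbT.
- rewrite mem_cat nears_cons nears_cat /= !inE !mem_cat => /orP[/IH|/IH'] [-> [->|->]];
    by split=> //; right; rewrite ?eqxx ?orbT.
Qed.

Lemma tree_cells s a l t c : tree s a l t -> c \in t ->
  kind c = s /\ (principal c = a \/ principal c \in nears (~~ s) t).
Proof.
case: s => -[{}a|{}a {}l {}t b]; try by rewrite inE => /eqP ->; split=> //; left.
  exact: (branch_cells (s := true) b).
exact: (branch_cells (s := false) b).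
Qed.

Section RoutingAreas.
Variables (I O : finType).
Implicit Types (N : net I O) (s : bool) (C : seq cell) (R : multirelation I O).

(** [R] fixes the size of every comb, so the wires of the two nets, listed by where they start, can
    be matched in order. Inputs and wires emitted by contraction combs determine the links; these
    and the wires emitted by cocontraction combs then determine the outputs. *)
Lemma canonical_unique R N1 N2 link1 T1 U1 link2 T2 U2 :
  canonical R N1 link1 T1 U1 -> canonical R N2 link2 T2 U2 -> net_equiv N1 N2.
Proof.
move=> [sz1 cT1 cU1 p1] [sz2 cT2 cU2 p2].
pose starts N (T : I -> seq cell) (U : O -> seq cell) := codom (inp N) ++
  gather (fun i => nears false (T i)) ++ gather (fun o => nears false (U o)).
have u_starts N T U : perm_eq (cells N) (gather T ++ gather U) -> uniq (starts N T U).
  move=> pN; have [uN _] := port_linear true N.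
  rewrite /starts -!nears_gather -nears_cat; apply: etrans uN; apply: perm_uniq.
  by rewrite perm_cat2l perm_sym; apply: (perm_nears false pN).
have szrow link i : (forall x, size (link x) = R x) ->
    size (row link i) = sumn [seq R (i, o) | o <- enum O].
  by move=> sz; rewrite size_gather; congr sumn; apply: eq_map => o.
have szcol link o : (forall x, size (link x) = R x) ->
    size (col link o) = sumn [seq R (i, o) | i <- enum I].
  by move=> sz; rewrite size_gather; congr sumn; apply: eq_map => i.
have szT i : size (nears false (T1 i)) = size (nears false (T2 i)).
  by rewrite (comb_size (cT1 i)) (comb_size (cT2 i)) !szrow.
have szU o : size (nears false (U1 o)) = size (nears false (U2 o)).
  by rewrite (comb_size (cU1 o)) (comb_size (cU2 o)) !szcol.
have [|f [injf]] := renaming_exists (u_starts _ _ _ p1) (u_starts _ _ _ p2).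
  rewrite !size_cat !size_codom !size_gather; congr (_ + (sumn _ + sumn _)).
    exact: eq_map.
  exact: eq_map.
move/eqP; rewrite !map_cat eqseq_cat ?size_map ?size_codom // => /andP[/eqP fi].
rewrite eqseq_cat; last first.
  by rewrite size_map !size_gather; congr sumn; apply: eq_map.
rewrite !map_gather => /andP[/eqP fT /eqP fU].
have {fi}fi i : f (inp N1 i) = inp N2 i.
  by move: fi; rewrite !codomE -map_comp => /eq_in_map; apply; rewrite mem_enum.
have {}fT := gather_inj _ fT; have {}fU := gather_inj _ fU.
have TP i : map f (row link1 i) = row link2 i /\ T2 i = rn f (T1 i).
  have c2 : comb true (f (inp N1 i)) (row link2 i) (T2 i) by rewrite fi.
  apply: (comb_true_map (cT1 i) c2); first by rewrite !szrow.
  by apply: fT => j; rewrite size_map.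
have flink x : map f (link1 x) = link2 x.
  case: x => i o; have [+ _] := TP i; rewrite map_gather => /gather_inj; apply=> o'.
  by rewrite size_map sz1 sz2.
have UP o : f (out N1 o) = out N2 o /\ U2 o = rn f (U1 o).
  have c2 : comb false (out N2 o) (map f (col link1 o)) (U2 o).
    have -> // : map f (col link1 o) = col link2 o.
    by rewrite map_gather /col /gather; congr flatten; apply: eq_map => i.
  apply: (comb_false_map (cU1 o) c2).
  by apply: fU => j; rewrite size_map.
apply: rst_step; constructor 1; exists f; split=> //; split.
- by apply/ffunP => i; rewrite ffunE fi.
- by apply/ffunP => o; rewrite ffunE; case: (UP o).
apply: perm_trans p2 _; rewrite perm_sym.
apply: perm_trans (perm_map (rename f) p1) _.
rewrite -/(rn f _) rn_cat !rn_gather /gather.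
have -> : [seq rn f (T1 i) | i <- enum I] = [seq T2 i | i <- enum I].
  by apply: eq_map => i; case: (TP i).
have -> // : [seq rn f (U1 o) | o <- enum O] = [seq U2 o | o <- enum O].
by apply: eq_map => o; case: (UP o).
Qed.

(** Each erasure renames the wires of the remaining identities, whence the map [g] in the induction.
    The labelling is carried along because its rank gives [a != b], which rules out closed wires. *)
Lemma erase_ids vin r N (ids : seq (bool * (wire * wire * wire))) rest :
  labelled 0 vin r N ->
  perm_eq (cells N) (flatten [seq id_cells id.1 id.2 | id <- ids] ++ rest) ->
  exists N' f, [/\ net_equiv N N', forall t (x : side I O t), port N' x = f (port N x),
    perm_eq (cells N') (rn f rest) & forall id, id \in ids -> f id.2.1.1 = f id.2.1.2].
Proof.
have [n] := ubnP (size ids); elim: n N ids rest => // n IH N ids rest.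
case: ids => [|[s [[a b] c]] ids] /= lt_n lab pN.
  by exists N, id; split=> //; [apply: equiv_refl|rewrite rn_id].
have ab : a != b.
  case: lab => phi [rho [_ _ /(_ (nd s a b c))]]; rewrite (perm_mem pN) mem_head => /(_ isT).
  by move=> h; apply/eqP => ab; move: h; rewrite ab; case: (s) => /= -[] *; lia.
have [N1 [e1 port1 c1]] := erase_id ab pN.
pose g (id : bool * (wire * wire * wire)) : bool * (wire * wire * wire) :=
  (id.1, (fuse a b id.2.1.1, fuse a b id.2.1.2, fuse a b id.2.2)).
have [|||N2 [f [e2 port2 c2 fid]]] := IH N1 (map g ids) (rn (fuse a b) rest).
- by rewrite size_map.
- exact: (labelled_equiv _ _ e1).1.
- suff -> : flatten [seq id_cells id.1 id.2 | id <- map g ids]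
      = rn (fuse a b) (flatten [seq id_cells id.1 id.2 | id <- ids]) by rewrite c1 rn_cat.
  rewrite /rn map_flatten -!map_comp; congr flatten; apply: eq_map => -[t [[x y] z]] /=.
  by rewrite rename_nd rename_lf.
exists N2, (f \o fuse a b); split.
- exact: equiv_trans e2.
- by move=> t x; rewrite port2 port1.
- by rewrite -rn_comp.
move=> id; rewrite inE => /orP[/eqP ->|idi] /=.
  by rewrite /fuse eqxx (negPf ab).
exact: (fid (g id) (map_f g idi)).
Qed.

Lemma canonical_area R N link T U vin r : labelled 0 vin r N -> canonical R N link T U ->
  exists N', routing_area R N' /\ net_equiv N N'.
Proof.
move=> lab [sz cT cU pN].
have [idsT tT] := fin_all_exists (fun i => comb_tree (cT i)).
have [idsU tU] := fin_all_exists (fun o => comb_tree (cU o)).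
have [uT {}tT] := fin_all_exists tT; have [uU {}tU] := fin_all_exists tU.
pose ids := gather (fun i => map (pair true) (idsT i)) ++
            gather (fun o => map (pair false) (idsU o)).
have idsE (X : finType) s (F : X -> seq (wire * wire * wire)) :
    flatten [seq id_cells id.1 id.2 | id <- gather (fun x => map (pair s) (F x))]
    = gather (fun x => flatten (map (id_cells s) (F x))).
  rewrite /gather; elim: (enum X) => //= x xs IH.
  by rewrite map_cat flatten_cat IH -map_comp.
have [|N' [f [e pf cf fid]]] := @erase_ids vin r N ids (gather uT ++ gather uU) lab.
  rewrite map_cat flatten_cat !idsE; apply: perm_trans pN _.
  have pT := perm_gather_cat (fun i => (tT i).1).
  have pU := perm_gather_cat (fun o => (tU o).1).
  apply: perm_trans (perm_cat pT pU) _.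
  by rewrite -!catA perm_cat2l perm_catCA.
exists N'; split=> //; exists (fun x => map f (link x)), (fun i => rn f (uT i)),
  (fun o => rn f (uU o)); split.
- by move=> x; rewrite size_map.
- move=> i; have -> : inp N' i = f (inp N i) by apply: (pf true).
  have := (tT i).2 f; rewrite /row map_gather; apply=> id idi.
  apply: (fid (true, id)); rewrite mem_cat; apply/orP; left.
  by apply/mem_gather; exists i; apply: map_f.
- move=> o; have -> : out N' o = f (out N o) by apply: (pf false).
  have := (tU o).2 f; rewrite /col map_gather; apply=> id ido.
  apply: (fid (false, id)); rewrite mem_cat; apply/orP; right.
  by apply/mem_gather; exists o; apply: map_f.
- by apply: perm_trans cf _; rewrite rn_cat !rn_gather.
Qed.

(** The principal wire of a cell of type ? starts at an input or at a contraction of the same tree,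
    never at a cell of type !, whereas every rule needs such a pair. *)
Lemma routing_area_normal R N : routing_area R N -> normal N.
Proof.
move=> [link [ti [to [_ hi ho pN]]]] N1 [lhs [rhs [rest [rl [_ _ pl _]]]]].
have [c' [c [c'N cN kc' kc cc']]] : exists c' c, [/\ c' \in cells N, c \in cells N,
    kind c' = false, kind c = true & principal c = principal c'].
  have sub c : c \in lhs -> c \in cells N by move=> cl; rewrite (perm_mem pl) mem_cat cl.
  case: rl sub {pl} => [a b c d f w x y z|c d f|a b c|c] sub.
  - exists (Cocontr a b c), (Contr c d f); split=> //; apply: sub; by rewrite !inE eqxx ?orbT.
  - exists (Coweak c), (Contr c d f); split=> //; apply: sub; by rewrite !inE eqxx ?orbT.
  - exists (Cocontr a b c), (Weak c); split=> //; apply: sub; by rewrite !inE eqxx ?orbT.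
  - exists (Coweak c), (Weak c); split=> //; apply: sub; by rewrite !inE eqxx ?orbT.
have {}pN : perm_eq (cells N) (gather ti ++ gather to) by [].
have wc' : principal c \in near false c' by rewrite cc' -kc' near_kind inE.
move: cN; rewrite (perm_mem pN) mem_cat => /orP[] /mem_gather[x cx]; last first.
  by have [] := tree_cells (s := false) (ho x) cx; rewrite kc.
have [_ [px|]] := tree_cells (s := true) (hi x) cx.
  have := port_count true N (principal c); have := mem_nears c'N wc'.
  have : principal c \in codom (port N (s:=true)) by rewrite px (codom_f (port N (s:=true))).
  by rewrite -!cnt_gt0 /=; clear; lia.
move=> /nearsP[d dx wd]; have [kd _] := tree_cells (s := true) (hi x) dx.
have dN : d \in cells N.
  by rewrite (perm_mem pN) mem_cat; apply/orP; left; apply/mem_gather; exists x.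
by have := near_inj dN c'N wd wc' => dc; move: kd; rewrite dc kc'.
Qed.

End RoutingAreas.

Theorem mainTheorem12 (I O : finType) (S : net I O) :
  routing_net S ->
  exists (R : multirelation I O) (N : net I O),
    [/\ routing_area R N,
        normal_form S N &
        forall N' : net I O, normal_form S N' -> net_equiv N' N].
Proof.
move=> corr.
have [r lab] := fin_all_exists (fun i => routing_labelled 0 (fun j => i == j : nat) corr).
pose R : multirelation I O := fun x => r x.1 x.2.
have cS : counts R S by split; [apply: routing_labelled|].
have [r1 lab1] := routing_labelled 1 (fun=> 0) corr.
have [N0 [red0 n0]] := normalizes lab1.
have [P0 [link0 [T0 [U0 [e0 c0]]]]] := normal_canonical n0 (counts_reduces red0 cS).
have [[r0 lab0] _] := counts_reduces red0 cS.
have [N [aN eN]] := canonical_area ((labelled_equiv _ _ e0).1 lab0) c0.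
exists R, N; split=> //.
  split; last exact: routing_area_normal aN.
  by apply: rt_trans red0 _; apply: reduces_equiv; apply: equiv_trans eN.
(* Since [N'] is also reached from [S], it has the same counts, hence a canonical form with the same
   matrix. *)
move=> N' [red' n'].
have [P' [link' [T' [U' [e' c']]]]] := normal_canonical n' (counts_reduces red' cS).
exact: equiv_trans e' (equiv_trans (canonical_unique c' c0) eN).
Qed.
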